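(* Let $n,N,k\in\mathbb N$, let $\Omega\subset\mathbb R^n$ be a bounded open set, and let $\mathrm H:\Omega\times\mathbb R^\Lambda\to[0,\infty)$ be a Carathéodory function with $\mathrm H(x,0)=0$ for a.e. $x\in\Omega$, satisfying the following two conditions. (1) There is a continuous function $c:[0,1]\times[0,\infty)\to[0,\infty)$ with $c(1,\cdot)=c(\cdot,0)=0$ and $c>0$ on $(0,1)\times(0,\infty)$ such that $$\mathrm H(x,tX)\le \mathrm H(x,X)-c(t,|X|)\qquad \forall\, t\in[0,1],\ \forall\, X\in\mathbb R^\Lambda,\ \text{a.e. } x\in\Omega .$$ (2) For every $R>0$ there is a non-decreasing $\omega_R\in C(0,\infty)$ with $\omega_R(0^+)=0$ such that $$|\mathrm H(x,X)-\mathrm H(x,X')|\le \omega_R(|X-X'|)\qquad \text{a.e. } x\in\Omega,\ \forall\, X,X'\in\overline{\mathbb B}_R(0),\ X\neq X'.$$ Then, for any map $u\in W^{k,\infty}(\Omega,\mathbb R^N)$, the following statements are equivalent: (i) $u$ satisfies the energy maximum principle for $\mathrm E_\infty$ in $\Omega$, i.e. $$\operatorname*{ess\,sup}_{U}\mathrm H\big(\cdot,\mathrm D^{\vec k}u\big)=\sup_{\partial U}\mathrm H\big(\cdot,\mathrm D^{\vec k}u\big)^*\qquad\forall\,U\subseteq\Omega\text{ open};$$ (ii) $u$ is an absolute minimiser with respect to compactly supported variations, i.e. $$\mathrm E_\infty(u,U)\le \mathrm E_\infty(u+\phi,U)\qquad\forall\,\phi\in W^{k,\infty}_c(U,\mathbb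 R^N),\ \forall\, U\subseteq\Omega\text{ open}.$$
   Context: Notation: $\mathbb R^\Lambda\cong\mathbb R^N\times\mathbb R^{Nn}\times\dots\times\mathbb R^{Nn^k}$, so $\Lambda=N(1+n+\dots+n^k)$; $\overline{\mathbb B}_R(0)$ is the closed ball of radius $R$ centred at $0$ in $\mathbb R^\Lambda$ and $|\cdot|$ is the Euclidean norm. $\mathrm H$ Carathéodory means: $x\mapsto \mathrm H(x,X)$ is Lebesgue measurable for every $X$, and $X\mapsto\mathrm H(x,X)$ is continuous for a.e. $x$. For $u\in W^{k,\infty}(\Omega,\mathbb R^N)$, the jet of order $k$ is $\mathrm D^{\vec k}u:=(u,\mathrm Du,\dots,\mathrm D^ku):\Omega\to\mathbb R^\Lambda$. The supremal functional is $$\mathrm E_\infty(u,U):=\operatorname*{ess\,sup}_{x\in U}\mathrm H\big(x,\mathrm D^{\vec k}u(x)\big),\qquad U\subseteq\Omega\text{ Lebesgue measurable}.$$ $W^{k,\infty}_c(U,\mathbb R^N)$ is the space of maps in $W^{k,\infty}(U,\mathbb R^N)$ with compact support in $U$. Essential limsup: for an open set $U\subseteq\Omega$ and $h\in L^\infty(U)$, $$h^*(x):=\lim_{\varepsilon\to0}\Big(\operatorname*{ess\,sup}_{B_\varepsilon(x)\cap U}h\Big),\qquad x\in\overline U .$$ In (i), for each open $U$, $\mathrm H(\cdot,\mathrm D^{\vec k}u)^*$ is the essential limsup of the restriction of $\mathrm H(\cdot,\mathrm D^{\vec k}u)$ to $U$. *)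

(* Defs.v *)
From HB Require Import structures.
From mathcomp Require Import all_boot all_order all_algebra.
From mathcomp Require Import all_classical all_reals all_analysis.
From mathcomp Require Import ess_sup_inf.

Set Implicit Arguments.
Unset Strict Implicit.
Unset Printing Implicit Defensive.

Import Order.TTheory GRing.Theory Num.Theory.
Import numFieldNormedType.Exports.

Local Open Scope classical_set_scope.
Local Open Scope ring_scope.

Section lebesgue_measure_rV.
Context (R : realType) (n : nat).
Implicit Types (p : 'rV[R]_n * 'rV[R]_n) (A : set 'rV[R]_n).

Definition box p : set 'rV[R]_n :=
  [set x | forall i, p.1 0 i < x 0 i <= p.2 0 i].

Definition box_vol p : R := \prod_(i < n) Num.max 0 (p.2 0 i - p.1 0 i).

(* Lebesgue outer measure, by countable (possibly finite or empty) collections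
   of boxes; it is a measure on the sigma-algebra given below. *)
Definition lebn A : \bar R :=
  ereal_inf [set (\esum_(p in D) (box_vol p)%:E)%E | D in
    [set D : set ('rV[R]_n * 'rV[R]_n) |
      countable D /\ A `<=` \bigcup_(p in D) box p]].

Lemma box_vol_ge0 p : 0 <= box_vol p.
Proof. by apply: prodr_ge0 => i _; rewrite le_max lexx. Qed.

Lemma lebn_ge0 A : (0 <= lebn A)%E.
Proof.
apply: le_ereal_inf_tmp => _ [D _ <-].
by apply: esum_ge0 => p _; rewrite lee_fin box_vol_ge0.
Qed.

Lemma lebn0 : lebn set0 = 0%E.
Proof.
apply/eqP; rewrite eq_le lebn_ge0 andbT.
by apply: ereal_inf_lbound; exists set0; rewrite ?esum_set0//=; split.
Qed.

Lemma le_lebn : {homo lebn : A B / A `<=` B >-> (A <= B)%E}.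
Proof.
move=> A B AB; apply: ereal_inf_le_tmp => _ [D [cD BD] <-].
by exists D => //; split => //; exact: subset_trans BD.
Qed.

Lemma lebn_sigma_subadditive : sigma_subadditive lebn.
Proof.
move=> A; have [[i ioo]|] := pselect (exists i, lebn (A i) = +oo%E).
  rewrite (eseries_pinfty _ _ ioo) ?leey// => k _.
  by rewrite -ltNye (lt_le_trans _ (lebn_ge0 _)).
rewrite -forallNE => Aoo; apply/lee_addgt0Pr => e e0.
rewrite (le_trans _ (epsilon_trick _ _ (ltW e0)))//; last first.
  by move=> k; exact: lebn_ge0.
have vol0 p : (0 <= (box_vol p)%:E)%E by rewrite lee_fin box_vol_ge0.
have /choice[D PD] : forall k, exists D : set ('rV[R]_n * 'rV[R]_n),
    [/\ countable D, A k `<=` \bigcup_(p in D) box p &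
     (\esum_(p in D) (box_vol p)%:E <= lebn (A k) + (e / (2 ^ k.+1)%:R)%:E)%E].
  move=> k; have Ak : lebn (A k) \is a fin_num.
    by rewrite ge0_fin_numE ?lebn_ge0// ltey; exact/eqP/Aoo.
  have ek : 0 < e / (2 ^ k.+1)%:R by rewrite divr_gt0// ltr0n expn_gt0.
  have [_ [D [cD AD] <-] Dlt] := lb_ereal_inf_adherent ek Ak.
  by exists D; split => //; exact: ltW.
apply: (@le_trans _ _ (\esum_(p in \bigcup_k D k) (box_vol p)%:E)%E).
  apply: ereal_inf_lbound; exists (\bigcup_k D k) => //; split.
    by apply: bigcup_countable => // k _; have [] := PD k.
  move=> x [k _ Akx]; have [_ /(_ _ Akx)[p Dp px] _] := PD k.
  by exists p => //; exists k.
rewrite seqDU_bigcup_eq (@esum_bigcupT _ _ _ (seqDU D))//.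
rewrite -nneseries_esumT; last by move=> k *; apply: esum_ge0.
apply: lee_nneseries => [k _ _|k _]; first exact: esum_ge0.
have [_ _] := PD k; apply: le_trans.
rewrite esum_mkcond [leRHS]esum_mkcond; apply: le_esum => p _.
case: ifPn => [|_]; last by case: ifPn.
by rewrite inE => pD; rewrite mem_set//; apply: subset_seqDU pD.
Qed.

HB.instance Definition _ := isOuterMeasure.Build R 'rV[R]_n lebn
  lebn0 lebn_ge0 le_lebn lebn_sigma_subadditive.

(* The measurable subsets of R^n are the Lebesgue measurable ones (not only the
   Borel ones): those satisfying Caratheodory's criterion for [lebn]. *)
HB.instance Definition _ := @isMeasurable.Build (caratheodory_display lebn)
  'rV[R]_n (caratheodory_measurable lebn)
  (caratheodory_measurable_set0 lebn)
  (@caratheodory_measurable_setC _ _ lebn)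
  (@caratheodory_measurable_bigcup _ _ lebn).

HB.instance Definition _ := isMeasure.Build _ 'rV[R]_n R lebn
  lebn0 lebn_ge0 (@caratheodory_measure_sigma_additive R _ lebn).

End lebesgue_measure_rV.

Section essential_suprema.
Context (R : realType) (n : nat).
Implicit Types (U : set 'rV[R]_n) (h : 'rV[R]_n -> R).

(* The library's norm and balls on row vectors are those of the sup norm. *)
Definition enorm m (x : 'rV[R]_m) : R := Num.sqrt (\sum_(i < m) x 0 i ^+ 2).

Definition eball (x : 'rV[R]_n) (e : R) : set 'rV[R]_n :=
  [set y | enorm (y - x) < e].

Definition ess_sup_on U h : \bar R :=
  ess_sup (@lebn R n) (patch (cst -oo%E) U (EFin \o h)).

(* The essential limsup of the restriction of [h] to [U]. *)
Definition ess_limsup U h (x : 'rV[R]_n) : \bar R :=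
  lim (ess_sup_on (eball x e `&` U) h @[e --> 0^'+]).

Definition bdry U : set 'rV[R]_n := closure U `\` interior U.

End essential_suprema.

Section sobolev.
Context (R : realType) (n N : nat).
Implicit Types (U K : set 'rV[R]_n) (f g phi : 'rV[R]_n -> R) (s : seq 'I_n).
Implicit Types (u : 'rV[R]_n -> 'rV[R]_N).

(* A list [s = [:: i1; ...; ij]] of directions encodes the derivative
   D_{i1} ... D_{ij} of order [size s]. *)
Definition pderiv s phi : 'rV[R]_n -> R :=
  foldr (fun i f x => 'D_(delta_mx 0 i) f x) phi s.

Definition smooth phi := forall s, continuous (pderiv s phi) /\
  forall i x, derivable (pderiv s phi) x (delta_mx 0 i).

Definition supp phi : set 'rV[R]_n := closure [set x | phi x != 0].

Definition test_function U phi :=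
  [/\ smooth phi, compact (supp phi) & supp phi `<=` U].

Definition loc_integrable U f := measurable_fun U f /\
  forall K, compact K -> K `<=` U ->
    (@lebn R n).-integrable K (EFin \o f).

Definition is_weak_deriv U s f g :=
  [/\ loc_integrable U f, loc_integrable U g &
   forall phi, test_function U phi ->
     \int[@lebn R n]_(x in U) (f x * pderiv s phi x) =
     (-1) ^+ size s * \int[@lebn R n]_(x in U) (g x * phi x)].

(* Unique up to Lebesgue-null sets when it exists; in particular, the weak
   derivative of order 0 is [f] a.e. *)
Definition weak_deriv U s f : 'rV[R]_n -> R :=
  get [set g | is_weak_deriv U s f g].

Definition Linfty U f :=
  measurable_fun U f /\ (ess_sup_on U (fun x => `|f x|%R) < +oo)%E.

Definition sobolev (k : nat) U u := forall a : 'I_N,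
  Linfty U (fun x => u x 0 a) /\
  forall s, (size s <= k)%N ->
    exists2 g, is_weak_deriv U s (fun x => u x 0 a) g & Linfty U g.

(* Compact support in [U], for functions defined up to null sets; the values
   outside of [U] are irrelevant. *)
Definition sobolev_c (k : nat) U u := sobolev k U u /\
  exists K, [/\ compact K, K `<=` U &
    {ae @lebn R n, forall x, (U `\` K) x -> u x = 0}].

End sobolev.

(* Coordinates of R^Lambda: a pair of a component [a < N] of the map and of a
   j-tuple of directions, for each order j <= k. *)
Definition jet_index (n N k : nat) : finType :=
  {j : 'I_k.+1 & ('I_N * j.-tuple 'I_n)%type}.

Definition Lambda n N k := #|jet_index n N k|.

Lemma LambdaE n N k : Lambda n N k = (N * \sum_(j < k.+1) n ^ j)%N.
Proof.
rewrite /Lambda card_tagged sumnE big_map big_enum /= big_distrr /=.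
by apply: eq_bigr => j _; rewrite card_prod card_tuple !card_ord.
Qed.

Section functional.
Context (R : realType) (n N k : nat).
Implicit Types (Omega U : set 'rV[R]_n) (u : 'rV[R]_n -> 'rV[R]_N).
Implicit Types (H : 'rV[R]_n -> 'rV[R]_(Lambda n N k) -> R).

Definition jet Omega u (x : 'rV[R]_n) : 'rV[R]_(Lambda n N k) :=
  \row_(i < Lambda n N k)
    let: existT _ (a, s) := enum_val i in
    weak_deriv Omega s (fun y => u y 0 a) x.

Definition E_infty Omega H u U : \bar R :=
  ess_sup_on U (fun x => H x (jet Omega u x)).

Definition energy_maximum_principle Omega H u :=
  forall U, open U -> U `<=` Omega ->
    let h := fun x => H x (jet Omega u x) in
    ess_sup_on U h = ereal_sup [set ess_limsup U h x | x in bdry U].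

(* [u + phi] is a map on Omega through the extension of [phi] by 0 outside of
   [U]. *)
Definition absolute_minimiser_c Omega H u :=
  forall U, open U -> U `<=` Omega ->
  forall phi : 'rV[R]_n -> 'rV[R]_N, sobolev_c k U phi ->
    (E_infty Omega H u U <=
     E_infty Omega H (u \+ patch (cst 0) U phi)%R U)%E.

Definition caratheodory_fun Omega H :=
  (forall X, measurable_fun Omega (H ^~ X)) /\
  {ae @lebn R n, forall x, Omega x -> continuous (H x)}.

End functional.

(* Main.v *)
Require Import Defs.
From HB Require Import structures.
From mathcomp Require Import all_boot all_order all_algebra.
From mathcomp Require Import all_classical all_reals all_analysis.
From mathcomp Require Import ess_sup_inf measurable_realfun.
From mathcomp Require Import ring lra.

Set Implicit Arguments.
Unset Strict Implicit.
Unset Printing Implicit Defensive.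

Import Order.TTheory GRing.Theory Num.Theory.
Import numFieldNormedType.Exports.

Local Open Scope classical_set_scope.
Local Open Scope ring_scope.

(** A maximum principle and a minimality property that look at the boundary
    from two sides.

    If the energy density h of u attains its essential supremum over U along
    the boundary of U, then a variation phi supported in a compact subset K of
    U cannot lower the energy: near the boundary u and u + phi have the same
    jet, so the essential limsup of h at boundary points is also a lower bound
    for the energy of u + phi [energy_maximum_principle_minimal].

    Conversely, suppose the limsup m of h along the boundary is smaller than
    the essential supremum M over U, and take m < a < b < M. By compactness of
    the boundary, h <= a almost everywhere outside a compact subset K of U
    [small_near_bdry]. Shrink u radially near K: with a cutoff z that is 1 near
    K and a small s > 0, compete with u - s z u. On K the jet of u is scaled by
    t = 1 - s, so by radial decay the density does not increase, and it drops by
    a fixed c0 > 0 wherever h > a, because there the jet stays away from 0.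
    Outside K the jet moves by at most a multiple of s, so by the modulus of
    continuity the density stays below b. The energy of the competitor is then
    at most max b (M - c0) < M, against minimality
    [minimal_energy_maximum_principle].

    Both directions compare jets of different maps, which are defined through a
    choice of weak derivatives. Three facts make this possible. Weak derivatives
    are determined almost everywhere, even locally [weak_deriv_local_unique];
    this is the fundamental lemma of the calculus of variations
    [fundamental_lemma], proved from the inner regularity of Lebesgue measure
    and from smooth cutoffs. Multiplication by a smooth compactly supported
    function preserves the Sobolev class [sobolev1M]. So does extension by zero
    of a compactly supported map [sobolev1_extend]: multiply the test functions
    by a cutoff. *)

(** * Lebesgue measure on row vectors *)

(** The map need not be injective: keeping one preimage of each point of the
    image leaves a subfamily of the right-hand sum. *)
Lemma le_esum_image (R : realType) (T : pointedType) (T' : choiceType)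
    (D : set T) (f : T -> T') (a : T' -> \bar R) :
  (forall y, 0 <= a y)%E ->
  (\esum_(y in f @` D) a y <= \esum_(x in D) a (f x))%E.
Proof.
move=> a0; pose g y := get [set x | D x /\ f x = y].
have gP y : (f @` D) y -> D (g y) /\ f (g y) = y.
  by move=> [x Dx fx]; apply: (@getPex _ [set x | D x /\ f x = y]); exists x.
have -> : f @` D = f @` (g @` (f @` D)).
  apply/seteqP; split => y.
    by move=> Dy; exists (g y); [exists y|case: (gP y)].
  by move=> [_ [z Dz <-] <-]; case: (gP z Dz) => _ ->.
have sub : g @` (f @` D) `<=` D by move=> _ [y Dy <-]; case: (gP y).
rewrite esum_image; last first.
  move=> _ _ /set_mem[y Dy <-] /set_mem[z Dz <-].
  by rewrite (gP y Dy).2 (gP z Dz).2 => ->.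
rewrite esum_mkcond [leRHS]esum_mkcond; apply: le_esum => x _.
case: ifPn => [|_]; last by case: ifPn.
by rewrite inE => /sub Dx; rewrite mem_set.
Qed.

Section lebn_theory.
Context (R : realType) (n : nat).
Notation mu := (@lebn R n).
Implicit Types (p : 'rV[R]_n * 'rV[R]_n) (A E O : set 'rV[R]_n).

Lemma lebn_box_le p : (lebn (box p) <= (box_vol p)%:E)%E.
Proof.
apply: ereal_inf_lbound; exists [set p].
  split; first exact: countable1.
  by move=> x px; exists p.
by rewrite esum_set1// lee_fin box_vol_ge0.
Qed.

(** A cover indexed by modified boxes [f p], some of which may coincide. *)
Lemma lebn_le_esum A D (f : 'rV[R]_n * 'rV[R]_n -> 'rV[R]_n * 'rV[R]_n) :
  countable D -> A `<=` \bigcup_(p in D) box (f p) ->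
  (lebn A <= \esum_(p in D) (box_vol (f p))%:E)%E.
Proof.
move=> cD AD; apply: le_trans (@le_esum_image R _ _ D f (fun p => (box_vol p)%:E) _);
  last first.
  by move=> p; rewrite lee_fin box_vol_ge0.
apply: ereal_inf_lbound; exists (f @` D) => //; split.
  exact: card_le_trans (card_image_le _ _) cD.
by move=> x /AD[p Dp px]; exists (f p) => //; exists p.
Qed.

Definition cut_le (i : 'I_n) (c : R) p : 'rV[R]_n * 'rV[R]_n :=
  (p.1, \row_j (if j == i then Num.min (p.2 0 j) c else p.2 0 j)).
Definition cut_gt (i : 'I_n) (c : R) p : 'rV[R]_n * 'rV[R]_n :=
  (\row_j (if j == i then Num.max (p.1 0 j) c else p.1 0 j), p.2).

(** Cutting a box by a hyperplane preserves the total volume, which is what the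
    Caratheodory criterion for half-spaces comes down to. *)
Lemma box_vol_cut i c p :
  box_vol (cut_le i c p) + box_vol (cut_gt i c p) = box_vol p.
Proof.
rewrite /box_vol (bigD1 i)//= (bigD1 i (F := fun j => Num.max 0
  ((cut_gt i c p).2 0 j - (cut_gt i c p).1 0 j)))//= [RHS](bigD1 i)//=.
rewrite !mxE !eqxx.
under eq_bigr => j ji do rewrite mxE (negbTE ji).
under [X in _ + _ * X]eq_bigr => j ji do rewrite mxE (negbTE ji).
rewrite -mulrDl; congr (_ * _).
set a := p.1 0 i; set b := p.2 0 i.
rewrite /Order.max /Order.min.
case: (ltP b c) => ?; case: (ltP a c) => ?;
  by repeat (case: ifPn; rewrite -?leNgt => ?); lra.
Qed.

Lemma measurable_halfspace (i : 'I_n) (c : R) :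
  measurable [set x : 'rV[R]_n | x 0 i <= c].
Proof.
apply: le_caratheodory_measurable => X; apply: le_ereal_inf_tmp => _ [D [cD XD] <-].
rewrite (_ : \esum_(p in D) _ = \esum_(p in D) ((box_vol (cut_le i c p))%:E
    + (box_vol (cut_gt i c p))%:E))%E; last first.
  by apply: eq_esum => p _; rewrite -EFinD box_vol_cut.
rewrite esumD; [|by move=> p _; rewrite lee_fin box_vol_ge0..].
apply: leeD; apply: lebn_le_esum => //.
- move=> x [/XD[p Dp px] /= xc]; exists p => // j; have := px j.
  rewrite mxE; case: eqP => [->|//] /andP[-> /= xp].
  by rewrite le_min xp.
- move=> x [/XD[p Dp px] /= /negP]; rewrite -ltNge => xc.
  exists p => // j; have := px j.
  by rewrite mxE; case: eqP => [->|//] /andP[xp ->]; rewrite gt_max xp xc.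
Qed.

Lemma measurable_halfspace_lt (i : 'I_n) (c : R) :
  measurable [set x : 'rV[R]_n | x 0 i < c].
Proof.
rewrite (_ : mkset _ =
    \bigcup_m [set x : 'rV[R]_n | x 0 i <= c - m.+1%:R^-1]); last first.
  apply/seteqP; split => x /=.
    rewrite -subr_gt0 => /ltr_add_invr[m mx]; exists m => //=.
    by rewrite add0r in mx; rewrite lerBrDl -lerBrDr ltW.
  by move=> [m _ /= xm]; apply: le_lt_trans xm _; rewrite ltrBlDr ltrDl.
by apply: bigcup_measurable => m _; exact: measurable_halfspace.
Qed.

Definition obox p : set 'rV[R]_n := [set x | forall i, p.1 0 i < x 0 i < p.2 0 i].

Lemma obox_sub_box p : obox p `<=` box p.
Proof. by move=> x px i; case/andP: (px i) => -> /ltW ->. Qed.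

Lemma measurable_obox p : measurable (obox p).
Proof.
rewrite (_ : obox p = \bigcap_(i in [set: 'I_n])
    (~` [set x | x 0 i <= p.1 0 i] `&` [set x | x 0 i < p.2 0 i])); last first.
  apply/seteqP; split => x /=.
    move=> px i _; case/andP: (px i) => pi ?; split => //=.
    by apply/negP; rewrite -ltNge.
  move=> px i; have [/= /negP + ->] := px i I.
  by rewrite -ltNge => ->.
apply: fin_bigcap_measurable => // i _; apply: measurableI.
  by apply: measurableC; exact: measurable_halfspace.
exact: measurable_halfspace_lt.
Qed.

Lemma open_obox p : open (obox p).
Proof.
rewrite openE => x px.
have := @filter_forall _ _
  (fun i (y : 'rV[R]_n) => p.1 0 i < y 0 i < p.2 0 i) (nbhs x) _; apply => i.
have : nbhs (x 0 i) `]p.1 0 i, p.2 0 i[%classic.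
  by apply: open_nbhs_nbhs; split; [exact: itv_open|rewrite /= in_itv/= px].
move=> xi; have := @coord_continuous R 1 n 0 i x _ xi.
move=> /nbhs_ballP[e /= e0 ei]; apply/nbhs_ballP; by exists e => //= y /ei.
Qed.

Lemma rV_ball (x y : 'rV[R]_n) e : 0 < e ->
  (forall i, `|x 0 i - y 0 i| < e) -> ball x e y.
Proof.
move=> e0 h; split => // i j; rewrite ord1 /ball /= /ball_ /=; exact: h.
Qed.

Lemma rV_ballE (x y : 'rV[R]_n) e : ball x e y -> forall i, `|x 0 i - y 0 i| < e.
Proof. by move=> [_ h] i; have := h 0 i. Qed.

Lemma rat_obox (x : 'rV[R]_n) e : 0 < e -> exists q : 'rV[rat]_n * 'rV[rat]_n,
  obox (map_mx ratr q.1, map_mx ratr q.2) x /\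
  obox (map_mx ratr q.1, map_mx ratr q.2) `<=` ball x e.
Proof.
move=> e0.
have /choice[a aP] i : exists q : rat, x 0 i - e < ratr q < x 0 i.
  have [|q] := @rat_in_itvoo R (x 0 i - e) (x 0 i); first lra.
  by rewrite in_itv /= => ?; exists q.
have /choice[b bP] i : exists q : rat, x 0 i < ratr q < x 0 i + e.
  have [|q] := @rat_in_itvoo R (x 0 i) (x 0 i + e); first lra.
  by rewrite in_itv /= => ?; exists q.
exists (\row_i a i, \row_i b i); split.
  by move=> i /=; rewrite !mxE; move: (aP i) (bP i) => /andP[_ ->] /andP[-> _].
move=> y yab; apply: rV_ball => // i; have /= := yab i; rewrite !mxE.
by move: (aP i) (bP i); rewrite ltr_norml => *; lra.
Qed.

(** An open set is the countable union of the rational open boxes in it. *)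
Lemma open_measurable_lebn O : open O -> measurable O.
Proof.
move=> oO.
pose F (q : 'rV[rat]_n * 'rV[rat]_n) :=
  if pselect (obox (map_mx ratr q.1, map_mx ratr q.2) `<=` O)
  then obox (map_mx ratr q.1, map_mx ratr q.2) else set0.
rewrite (_ : O = \bigcup_q F q); last first.
  apply/seteqP; split => x.
    move=> /oO /nbhs_ballP[e /= e0 eO].
    have [q [qx qe]] := rat_obox x e0.
    exists q => //; rewrite /F; case: pselect => //= nq.
    by exfalso; apply: nq; apply: subset_trans eO.
  by move=> [q _]; rewrite /F; case: pselect => //= qO /qO.
apply: countable_bigcupT_measurable => [|q].
  exact: countableP.
by rewrite /F; case: pselect => //= _; exact: measurable_obox.
Qed.

Lemma closed_measurable_lebn E : closed E -> measurable E.
Proof.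
move=> cE; rewrite -(setCK E); apply: measurableC.
by apply: open_measurable_lebn; exact: closed_openC.
Qed.

Lemma compact_closed_rV (K : set 'rV[R]_n) : compact K -> closed K.
Proof. by apply: compact_closed; exact: norm_hausdorff. Qed.

Lemma compact_measurable_lebn E : compact E -> measurable E.
Proof. by move/compact_closed_rV; exact: closed_measurable_lebn. Qed.

Lemma lebn_cover_le A (p : 'rV[R]_n * 'rV[R]_n) : A `<=` box p ->
  (lebn A <= (box_vol p)%:E)%E.
Proof. by move=> Ap; apply: le_trans (lebn_box_le p); exact: le_lebn. Qed.

Lemma le_coord_norm (x : 'rV[R]_n) i : `|x 0 i| <= `|x|.
Proof.
by rewrite /Num.norm /= mx_normrE (le_bigmax _ (fun ij => `|x ij.1 ij.2|) (0, i)).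
Qed.

Lemma le_norm_coord (x : 'rV[R]_n) M : 0 <= M ->
  (forall i, `|x 0 i| <= M) -> `|x| <= M.
Proof.
move=> M0 xM; rewrite /Num.norm /= mx_normrE; apply: bigmax_le => // -[a i] _ /=.
by rewrite ord1.
Qed.

Lemma lebn_bounded A : bounded_set A -> (lebn A < +oo)%E.
Proof.
move=> [M [_ /(_ (`|M| + 1))]] AM.
apply: le_lt_trans (ltry (box_vol (const_mx (- (`|M| + 2)), const_mx (`|M|+2)))).
apply: lebn_cover_le => x Ax i /=; rewrite !mxE.
have Mle := ler_norm M.
have MM : M < `|M| + 1 by lra.
have := le_trans (le_coord_norm x i) (AM MM x Ax).
by rewrite ler_norml => *; lra.
Qed.

Lemma caratheodory_null A : lebn A = 0%E -> measurable A.
Proof.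
move=> A0; apply: le_caratheodory_measurable => X.
rewrite -[leRHS]add0e; apply: leeD; last by apply: le_lebn => x [].
by rewrite -A0; apply: le_lebn => x [].
Qed.

Lemma negligible_lebn A : mu.-negligible A <-> lebn A = 0%E.
Proof.
split=> [[B [mB B0 AB]]|A0].
  by apply/eqP; rewrite eq_le lebn_ge0 andbT -[leRHS]B0; exact: le_lebn.
by exists A; split => //; exact: caratheodory_null.
Qed.

Lemma lebn_translate_le A v : (lebn [set x | A (x - v)%R] <= lebn A)%E.
Proof.
apply: le_ereal_inf_tmp => _ [D [cD AD] <-].
pose f p : 'rV[R]_n * 'rV[R]_n := (p.1 + v, p.2 + v).
rewrite (_ : \esum_(p in D) _ = \esum_(p in D) (box_vol (f p))%:E)%E.
  apply: lebn_le_esum => // x /= /AD[p Dp px]; exists p => // i.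
  by have := px i; rewrite /f /= !mxE ltrBrDr lerBlDr.
apply: eq_esum => p _; congr (_%:E); apply: eq_bigr => i _.
by rewrite /f /= !mxE; congr (Num.max _ _); ring.
Qed.

Lemma rat_dense (x : 'rV[R]_n) e : 0 < e ->
  exists q : 'rV[rat]_n, ball x e (map_mx ratr q).
Proof.
move=> e0.
have /choice[a aP] i : exists q : rat, x 0 i - e < ratr q < x 0 i.
  have [|q] := @rat_in_itvoo R (x 0 i - e) (x 0 i); first lra.
  by rewrite in_itv /= => ?; exists q.
exists (\row_i a i); apply: rV_ball => // i; rewrite !mxE.
by move: (aP i); rewrite ltr_norml => *; lra.
Qed.

Lemma countable_cover_null (I : countType) (F : I -> set 'rV[R]_n) A :
  A `<=` \bigcup_i F i -> (forall i, lebn (F i) = 0%E) -> lebn A = 0%E.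
Proof.
move=> AF F0; apply/negligible_lebn; apply: negligibleS AF _.
rewrite (_ : \bigcup_i F i = \bigcup_k
    (if unpickle k is Some i then F i else set0)); last first.
  apply/seteqP; split => x [i _ Fx].
    by exists (pickle i) => //; rewrite pickleK.
  by move: Fx; case: unpickle => // j Fx; exists j.
apply: negligible_bigcup => k; case: unpickle => [i|].
  by apply/negligible_lebn.
exact: negligible_set0.
Qed.

(** Countably many translates of a nonempty open set cover the space. *)
Lemma open_null_setT O : open O -> O !=set0 -> lebn O = 0%E ->
  forall A, lebn A = 0%E.
Proof.
move=> oO [y Oy] O0 A.
have /nbhs_ballP[e /= e0 eO] := oO _ Oy.
apply: (@countable_cover_null _ (fun q : 'rV[rat]_n =>
  [set x | O (x - (map_mx ratr q - y))])).
  move=> x _; have [q xq] := rat_dense x e0; exists q => //=.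
  apply: eO; apply: rV_ball => // i; have := rV_ballE xq i.
  by rewrite !mxE -normrN; congr (_ < _); congr (`|_|); ring.
move=> q; apply/eqP; rewrite eq_le lebn_ge0 andbT -[leRHS]O0.
exact: lebn_translate_le.
Qed.

Definition enlarge p (h : R) : 'rV[R]_n * 'rV[R]_n := (p.1, p.2 + const_mx h).

Lemma box_vol_enlarge p e : 0 < e ->
  exists2 h, 0 < h & box_vol (enlarge p h) <= box_vol p + e.
Proof.
move=> e0.
pose F h := \prod_(i < n) Num.max 0 (p.2 0 i + h - p.1 0 i).
have FE h : box_vol (enlarge p h) = F h.
  by apply: eq_bigr => i _; rewrite !mxE.
have F0 : box_vol p = F 0 by apply: eq_bigr => i _; rewrite addr0.
have cF : continuous F.
  apply: continuous_big => [x|i _].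
    by apply: cvgM; [exact: cvg_fst|exact: cvg_snd].
  apply: (@max_fun_continuous _ _ R (cst 0) (fun h => p.2 0 i + h - p.1 0 i)).
    by move=> x; exact: cvg_cst.
  move=> x; apply: cvgB; last exact: cvg_cst.
  by apply: cvgD; [exact: cvg_cst|exact: cvg_id].
have /cvgrPdist_lt/(_ _ e0) := cF 0.
move=> /nbhs_ballP[d /= d0 dF].
have d20 : 0 < d / 2 by rewrite divr_gt0.
exists (d / 2) => //; rewrite FE F0.
have /dF : ball (0 : R) d (d / 2).
  by rewrite /ball /= sub0r normrN gtr0_norm// ltr_pdivrMr// mulr_natr mulr2n ltrDl.
by rewrite ltr_norml => /andP[? ?]; lra.
Qed.

(** Enlarge each box of an almost optimal cover to an open one, the i-th of them
    at a cost of at most [e / 2 ^ (i + 2)]. *)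
Lemma lebn_outer_regular A e : (lebn A < +oo)%E -> 0 < e ->
  exists O, [/\ open O, A `<=` O & (lebn O <= lebn A + e%:E)%E].
Proof.
move=> Aoo e0.
have Afin : lebn A \is a fin_num by rewrite ge0_fin_numE// lebn_ge0.
have e20 : 0 < e / 2 by rewrite divr_gt0.
have [_ [D [cD AD] <-] Dlt] := lb_ereal_inf_adherent e20 Afin.
have /pcard_leP/unsquash iota := cD.
pose ee p := e / 2 / (2 ^ (iota p).+1)%:R.
have ee0 p : 0 < ee p by rewrite divr_gt0// ltr0n expn_gt0.
have /choice[h hP] p : exists h, 0 < h /\ box_vol (enlarge p h) <= box_vol p + ee p.
  by have [h] := box_vol_enlarge p (ee0 p); exists h.
exists (\bigcup_(p in D) obox (enlarge p (h p))); split.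
- apply: bigcup_open => p _; exact: open_obox.
- move=> x /AD[p Dp px]; exists p => // i; rewrite /enlarge /= !mxE.
  have [h0 _] := hP p.
  by case/andP: (px i) => -> /le_lt_trans -> //; rewrite ltrDl.
apply: (@le_trans _ _ (\esum_(p in D) (box_vol (enlarge p (h p)))%:E)%E).
  apply: lebn_le_esum => // x [p Dp px]; exists p => //.
  exact: obox_sub_box.
apply: (@le_trans _ _ (\esum_(p in D) ((box_vol p)%:E + (ee p)%:E))%E).
  apply: le_esum => p _; rewrite -EFinD lee_fin; exact: (hP p).2.
rewrite esumD; last 2 first.
- by move=> p _; rewrite lee_fin box_vol_ge0.
- by move=> p _; rewrite lee_fin ltW.
rewrite [in leRHS](splitr e) EFinD addeA; apply: leeD; first exact: ltW.
have tail0 k : (0 <= (e / 2 / (2 ^ k.+1)%:R)%:E)%E.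
  by rewrite lee_fin ltW// divr_gt0// ltr0n expn_gt0.
rewrite -(@esum_image _ _ _ D iota (fun k => (e / 2 / (2 ^ k.+1)%:R)%:E)).
  apply: le_trans (epsilon_trick0 xpredT (ltW e20)).
  rewrite nneseries_esumT// esum_mkcond [leRHS]esum_mkcond.
  by apply: le_esum => k _; rewrite in_setT; case: ifPn.
by move=> x y xD yD; apply: inj.
Qed.

(** In a large ball, take away an open set that covers what is not in [E] and
    exceeds it in measure by at most half of what [E] has in the ball. *)
Lemma lebn_inner_regular E : measurable E -> lebn E != 0%E ->
  exists C, [/\ compact C, C `<=` E & lebn C != 0%E].
Proof.
move=> mE E0.
pose B m : set 'rV[R]_n := [set x | `|x| <= m%:R].
have cB m : closed (B m).
  rewrite /B (_ : mkset _ = Num.norm @^-1` [set r : R | r <= m%:R])//.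
  apply: closed_comp; last exact: closed_le.
  by move=> x _; exact: norm_continuous.
have bB m A : A `<=` B m -> bounded_set A.
  move=> AB; exists m%:R; split; first exact: num_real.
  by move=> r mr x /AB /le_trans; apply; exact: ltW.
have [m Em0] : exists m, lebn (E `&` B m) != 0%E.
  apply: contrapT => /forallNP Em; move/eqP: E0; apply.
  apply: (@countable_cover_null _ (fun m => E `&` B m)) => [x Ex|m]; last first.
    by have /negP := Em m; rewrite negbK => /eqP.
  exists (Num.Def.archi_bound `|x|) => //; split => //.
  by rewrite /B /= ltW// archi_boundP.
have mB : measurable (B m) by exact: closed_measurable_lebn.
have mEm : measurable (E `&` B m) by exact: measurableI.
pose D := B m `\` (E `&` B m).
have mD : measurable D by exact: measurableD.
have Doo : (lebn D < +oo)%E by apply: lebn_bounded; apply: (bB m) => x [].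
have Eoo : (lebn (E `&` B m) < +oo)%E by apply: lebn_bounded; apply: (bB m) => x [].
have Efin : lebn (E `&` B m) \is a fin_num by rewrite ge0_fin_numE// lebn_ge0.
have Dfin : lebn D \is a fin_num by rewrite ge0_fin_numE// lebn_ge0.
pose r := fine (lebn (E `&` B m)).
have r0 : 0 < r.
  by rewrite fine_gt0// Eoo andbT lt_neqAle eq_sym Em0 lebn_ge0.
have r20 : 0 < r / 2 by rewrite divr_gt0.
have [G [oG DG Gle]] := lebn_outer_regular Doo r20.
exists (B m `\` G); split.
- apply: bounded_closed_compact; first by apply: (bB m) => x [].
  by rewrite setDE; apply: closedI => //; exact: open_closedC.
- by move=> x [Bx nGx]; apply: contrapT => nEx; apply: nGx; apply: DG; split => // -[].
apply/eqP => C0.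
have : (lebn (B m) <= lebn D + (r / 2)%:E)%E.
  apply: le_trans Gle; rewrite -[leRHS]adde0 -C0.
  apply: le_trans (outer_measureU2 (@lebn R n) G (B m `\` G)).
  by apply: le_lebn => x Bx; have [?|?] := pselect (G x); [left|right].
have -> : lebn (B m) = (lebn D + lebn (E `&` B m))%E.
  rewrite -measureU//; first by rewrite setUC setDUK//; exact: subIsetr.
  by rewrite /D setDE -setIA setICl setI0.
by rewrite leeD2lE// -(fineK Efin) lee_fin -/r; lra.
Qed.

End lebn_theory.

(** * Smooth functions *)

Section real_continuity.
Context (R : realType) (T : topologicalType).
Implicit Types f g : T -> R.

Lemma continuous_addf f g : continuous f -> continuous g ->
  continuous (fun x => f x + g x).
Proof. by move=> cf cg x; apply: cvgD; [exact: cf|exact: cg]. Qed.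

Lemma continuous_mulf f g : continuous f -> continuous g ->
  continuous (fun x => f x * g x).
Proof. by move=> cf cg x; apply: cvgM; [exact: cf|exact: cg]. Qed.

Lemma continuous_invf f : continuous f -> (forall x, f x != 0) ->
  continuous (fun x => (f x)^-1).
Proof. by move=> cf f0 x; apply: cvgV; [exact: f0|exact: cf]. Qed.

End real_continuity.

Section line_derivative.
Context (R : realType) (V : normedModType R).
Implicit Types (f g : V -> R) (x v : V).

(** Reduces directional derivatives to one-variable ones. *)
Lemma is_derive_line f x v (df : R) :
  is_derive (0 : R) (1 : R) (fun h : R => f (h *: v + x)) df -> is_derive x v f df.
Proof.
set g := fun h : R => _ => -[dg gE].
have E : (fun h : R => h^-1 *: ((g \o shift 0) (h *: (1 : R)) - g 0)) =
    (fun h : R => h^-1 *: ((f \o shift x) (h *: v) - f x)).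
  apply/funext => h; rewrite /g /shift /= addr0 scale0r add0r.
  by rewrite /GRing.scale /= mulr1.
move: dg gE; rewrite /derivable /derive E => dg gE.
by split.
Qed.

End line_derivative.

Section flat.
Context (R : realType).

(** The functions [t ^ - m * exp (- 1 / t)], extended by zero to nonpositive [t];
    the negative powers make the family stable under derivation. *)
Definition flat (m : nat) (t : R) : R :=
  if 0 < t then t^-1 ^+ m * expR (- t^-1) else 0.

(** From [exp y >= (y / k) ^ k] with [k = m + 2] and [y = 1 / t]; the quadratic
    bound gives the derivative at 0. *)
Lemma flat_le m : exists2 C, 0 <= C & forall t, `|flat m t| <= C * t ^+ 2.
Proof.
pose k := m.+2; exists (k%:R ^+ k) => [|t]; first by rewrite exprn_ge0.
rewrite /flat; case: ifPn => [t0|_]; last first.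
  by rewrite normr0 mulr_ge0 ?sqr_ge0 ?exprn_ge0.
have kt : 0 < k%:R * t by rewrite mulr_gt0.
have ek : expR (- t^-1) <= (k%:R * t) ^+ k.
  have tE : t^-1 = k%:R * (k%:R * t)^-1.
    by rewrite invfM mulrA mulfV ?mul1r// pnatr_eq0.
  rewrite expRN tE expRM_natl -exprVn lerXn2r// ?nnegrE.
  - by rewrite invr_ge0 expR_ge0.
  - exact: ltW.
  - rewrite invf_ple ?posrE ?expR_gt0//.
    by apply: le_trans (expR_ge1Dx _); rewrite lerDr.
rewrite exprVn ger0_norm ?mulr_ge0 ?expR_ge0 ?invr_ge0 ?exprn_ge0 ?(ltW t0)//.
apply: (@le_trans _ _ (t ^- m * (k%:R * t) ^+ k)).
  by rewrite ler_wpM2l// invr_ge0 exprn_ge0// ltW.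
rewrite exprMn mulrCA ler_wpM2l ?exprn_ge0//.
by rewrite /k -addn2 exprD mulrA mulVf ?mul1r// expf_neq0// gt_eqF.
Qed.

Lemma flat_is_derive m (t : R) :
  is_derive t 1 (flat m) (- m%:R * flat m.+1 t + flat m.+2 t).
Proof.
case: (ltgtP 0 t) => [t0|t0|<-].
- have tn0 : t != 0 by rewrite gt_eqF.
  have di : is_derive t 1 (fun s : R => s^-1) (- t ^- 2).
    apply: (is_derive_eq (@is_deriveV R id t 1 1 tn0 (is_derive_id t 1))).
    by rewrite /GRing.scale /= mulr1.
  apply: (@near_eq_is_derive _ _ _
      ((fun s => s^-1) ^+ m * (expR \o (fun s => - s^-1)))).
    have : nbhs t `]0, +oo[%classic.
      by apply: open_nbhs_nbhs; split; [exact: interval_open|rewrite /= in_itv/= t0].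
    apply: filterS => s; rewrite /= in_itv /= andbT /flat => ->.
    by rewrite fctE exprfctE.
  have de : is_derive t 1 (expR \o (fun s : R => - s^-1))
      (expR (- t^-1) * - - t ^- 2).
    by apply: is_derive1_comp; apply: is_deriveN.
  have dm := is_deriveX m di.
  apply: (is_derive_eq (is_deriveM dm de)).
  rewrite /flat t0 /GRing.scale /= exprfctE; set y := t^-1.
  rewrite opprK -exprVn -/y; case: m {dm} => [|m] /=; rewrite !exprS; ring.
- apply: (@near_eq_is_derive _ _ _ (cst 0)).
    have : nbhs t `]-oo, 0[%classic.
      by apply: open_nbhs_nbhs; split; [exact: interval_open|rewrite /= in_itv/= t0].
    apply: filterS => s; rewrite /= in_itv /= /flat => s0.
    by rewrite ltNge ltW.
  by rewrite /flat (ltNge 0 t) (ltW t0)/= mulr0 addr0; exact: is_derive_cst.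
- rewrite /flat ltxx mulr0 addr0.
  have [C C0 Cle] := flat_le m.
  have cv : (fun h : R => h^-1 *: ((flat m \o shift 0) (h *: (1 : R)) - flat m 0))
      @ 0^' --> (0 : R).
    apply/cvgr0Pnorm_lt => e e0; near=> h.
    have h0 : h != 0 by near: h; exact: nbhs_dnbhs_neq.
    rewrite /= /shift /= addr0 {2}/flat ltxx subr0 /GRing.scale /= mulr1 normrM.
    have hC : `|h| < e / (C + 1).
      near: h; apply: dnbhs0_lt; apply: divr_gt0 => //; lra.
    have h00 : 0 < `|h| by rewrite normr_gt0.
    rewrite normfV ltr_pdivrMl//; apply: le_lt_trans (Cle h) _.
    rewrite -real_normK ?num_real// expr2 mulrA [ltRHS]mulrC ltr_pM2r//.
    move: hC; rewrite ltr_pdivlMr; last lra.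
    by rewrite mulrDr mulr1; lra.
  by split; [apply: cvgP cv|rewrite /derive (cvg_lim _ cv)].
Unshelve. all: by end_near. Qed.

Lemma flat_continuous m : continuous (flat m).
Proof.
move=> t; apply: differentiable_continuous; apply/derivable1_diffP.
by have [] := flat_is_derive m t.
Qed.

Lemma flat_ge0 m t : 0 <= flat m t.
Proof.
rewrite /flat; case: ifPn => // t0.
by rewrite mulr_ge0 ?expR_ge0// exprn_ge0// invr_ge0 ltW.
Qed.

Lemma flat_gt0 m t : (0 < flat m t) = (0 < t).
Proof.
rewrite /flat; case: ifPn => [t0|]; last by rewrite ltxx.
by rewrite mulr_gt0 ?expR_gt0// exprn_gt0// invr_gt0.
Qed.

End flat.

Section smooth_functions.
Context (R : realType) (n : nat).
Implicit Types (f g : 'rV[R]_n -> R).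

Lemma pderiv_rcons f s i : pderiv (rcons s i) f = pderiv s (pderiv [:: i] f).
Proof. by rewrite /pderiv foldr_rcons. Qed.

(** A class closed under partial derivatives, so that all its members are
    smooth; it avoids formulas for iterated derivatives of products and
    inverses. *)
Inductive smooth_expr : ('rV[R]_n -> R) -> Prop :=
| se_smooth f : smooth f -> smooth_expr f
| se_cst c : smooth_expr (fun=> c)
| se_flat m a b i : smooth_expr (fun x => flat m (a * x 0 i + b))
| se_add f g : smooth_expr f -> smooth_expr g ->
    smooth_expr (fun x => f x + g x)
| se_mul f g : smooth_expr f -> smooth_expr g ->
    smooth_expr (fun x => f x * g x)
| se_inv f : smooth_expr f -> (forall x, f x != 0) ->
    smooth_expr (fun x => (f x)^-1).

Lemma smooth_expr_deriv f : smooth_expr f -> continuous f /\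
  forall i, exists2 f', smooth_expr f' &
    forall x, is_derive x (delta_mx 0 i) f (f' x).
Proof.
elim => {f} [f fs|c|m a b i|f g _ [cf df] _ [cg dg]|f g sf [cf df] sg [cg dg]
    |f sf [cf df] f0].
- split; first exact: (fs [::]).1.
  move=> i; exists (pderiv [:: i] f); last first.
    by move=> x; split => //; exact: (fs [::]).2.
  by apply: se_smooth => s; rewrite -pderiv_rcons; exact: fs.
- split; first exact: cst_continuous.
  by move=> i; exists (fun=> 0); [exact: se_cst|move=> x; exact: is_derive_cst].
- split.
    move=> x; apply: (@continuous_comp _ _ _ (fun x : 'rV[R]_n => a * x 0 i + b)
      (flat m)); last exact: flat_continuous.
    apply: continuous_addf; last exact: cst_continuous.
    by apply: continuous_mulf; [exact: cst_continuous|exact: coord_continuous].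
  move=> j; exists (fun x => (a * (delta_mx 0 j : 'rV[R]_n) 0 i) *
      (- m%:R * flat m.+1 (a * x 0 i + b) + flat m.+2 (a * x 0 i + b))).
    apply: se_mul; first exact: se_cst.
    apply: se_add; last exact: se_flat.
    by apply: se_mul; [exact: se_cst|exact: se_flat].
  move=> x; apply: is_derive_line.
  set d := (delta_mx 0 j : 'rV[R]_n) 0 i.
  have dl : is_derive (0 : R) 1
      (fun h : R => a * (h *: delta_mx 0 j + x : 'rV[R]_n) 0 i + b) (a * d).
    rewrite (_ : (fun h => _) = fun h : R => (a * d) *: h + (a * x 0 i + b));
      last first.
      by apply/funext => h; rewrite !mxE /d mxE /GRing.scale /=; ring.
    apply: (is_derive_eq (is_deriveD (is_deriveZ (a * d) (is_derive_id _ _))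
      (is_derive_cst _ _ _))).
    by rewrite addr0 /GRing.scale /= mulr1.
  apply: (is_derive_eq (is_derive1_comp (flat_is_derive m _) dl)).
  by rewrite scale0r add0r mulrC.
- split; first exact: continuous_addf.
  move=> i; have [f' sf' df'] := df i; have [g' sg' dg'] := dg i.
  exists (fun x => f' x + g' x); first exact: se_add.
  by move=> x; exact: is_deriveD.
- split; first exact: continuous_mulf.
  move=> i; have [f' sf' df'] := df i; have [g' sg' dg'] := dg i.
  exists (fun x => f x * g' x + g x * f' x).
    by apply: se_add; apply: se_mul.
  by move=> x; exact: is_deriveM.
- split; first exact: continuous_invf.
  move=> i; have [f' sf' df'] := df i.
  exists (fun x => -1 * (f' x * ((f x)^-1 * (f x)^-1))).
    apply: se_mul; first exact: se_cst.
    by apply: se_mul => //; apply: se_mul; apply: se_inv.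
  move=> x; have [dfx fE] := df' x; split; first exact: derivableV.
  by rewrite deriveV// fE /GRing.scale /= -exprVn expr2; ring.
Qed.

Lemma smooth_exprP f : smooth_expr f <-> smooth f.
Proof.
split; last exact: se_smooth.
move=> sf s; have sfs : smooth_expr (pderiv s f).
  elim: s => //= i s /smooth_expr_deriv[_ /(_ i)[g sg dg]].
  by rewrite (_ : (fun x => _) = g)//; apply/funext => x; apply: derive_val.
have [cs ds] := smooth_expr_deriv sfs; split => // i x.
by have [g _ /(_ x)[]] := ds i.
Qed.

Lemma smooth_continuous f : smooth f -> continuous f.
Proof. by move=> /(_ [::])[]. Qed.

Lemma smooth_pderiv f s : smooth f -> smooth (pderiv s f).
Proof.
elim: s => //= i s IH /IH sf t.
by have := sf (rcons t i); rewrite pderiv_rcons.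
Qed.

Lemma smooth_cst (c : R) : smooth (fun _ : 'rV[R]_n => c).
Proof. by apply/smooth_exprP; exact: se_cst. Qed.

Lemma smoothD f g : smooth f -> smooth g -> smooth (fun x => f x + g x).
Proof. by move=> *; apply/smooth_exprP; apply: se_add; apply: se_smooth. Qed.

Lemma smoothM f g : smooth f -> smooth g -> smooth (fun x => f x * g x).
Proof. by move=> *; apply/smooth_exprP; apply: se_mul; apply: se_smooth. Qed.

Lemma pderiv1M f g i x : smooth f -> smooth g ->
  pderiv [:: i] (fun y => f y * g y) x =
  f x * pderiv [:: i] g x + g x * pderiv [:: i] f x.
Proof.
move=> sf sg; rewrite /pderiv /=; apply: derive_val.
apply: is_deriveM; split => //; [exact: (sf [::]).2|exact: (sg [::]).2].
Qed.

Lemma pderiv_local f g s (U : set 'rV[R]_n) : open U ->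
  (forall x, U x -> f x = g x) -> forall x, U x -> pderiv s f x = pderiv s g x.
Proof.
move=> oU fg; elim: s => //= i s IH x Ux; apply: near_eq_derive.
by near=> y; apply: IH; near: y; exact: open_nbhs_nbhs.
Unshelve. all: by end_near. Qed.

Lemma supp_pderiv f s : supp (pderiv s f) `<=` supp f.
Proof.
have op : open (~` supp f) by apply: closed_openC; exact: closed_closure.
have cl : closed (supp f) by exact: closed_closure.
have f0 y : (~` supp f) y -> f y = (fun=> 0) y.
  move=> fy; apply: contrapT => fy0; apply: fy; apply: subset_closure.
  exact/eqP.
have p0 : pderiv s (fun _ : 'rV[R]_n => 0 : R) = fun=> 0.
  elim: s => //= i s IH; apply/funext => x.
  by rewrite /pderiv /= -/(pderiv s _) IH derive_cst.
rewrite [X in _ `<=` X](closure_id _).1//; apply: closure_subset => x /= /eqP fx.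
apply: contrapT => nx; apply: fx.
by rewrite (pderiv_local s op f0 nx) p0.
Qed.

End smooth_functions.

(** * Cutoff functions *)

Section cutoff.
Context (R : realType) (n : nat).
Implicit Types (f g : 'rV[R]_n -> R) (c x y : 'rV[R]_n).

Lemma compact_norm_ball c r : compact [set y : 'rV[R]_n | `|y - c| <= r].
Proof.
apply: bounded_closed_compact.
  exists (r + `|c|); split; first exact: num_real.
  move=> s rs y /= yr; apply: le_trans (ltW rs).
  by rewrite -[y](subrK c); apply: le_trans (ler_normD _ _) _; rewrite lerD2r.
rewrite (_ : mkset _ = (fun y => `|y - c|) @^-1` [set s : R | s <= r])//.
apply: closed_comp; last exact: closed_le.
move=> y _; apply: (@continuous_comp _ _ _ (fun y => y - c) Num.norm).
  by apply: continuousB => //; exact: cst_continuous.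
exact: norm_continuous.
Qed.

Lemma norm_open_ball c r : open [set y : 'rV[R]_n | `|y - c| < r].
Proof.
rewrite (_ : mkset _ = (fun y => `|y - c|) @^-1` [set s : R | s < r])//.
apply: open_comp; last exact: open_lt.
move=> y _; apply: (@continuous_comp _ _ _ (fun y => y - c) Num.norm).
  by apply: continuousB => //; exact: cst_continuous.
exact: norm_continuous.
Qed.

Definition step (t : R) : R := flat 0 t / (flat 0 t + flat 0 (1 - t)).

Lemma step_den t : 0 < flat 0 t + flat 0 (1 - t) :> R.
Proof.
have [t0|t0] := ltP 0 t.
  by rewrite ltr_pwDl ?flat_gt0 ?flat_ge0.
by rewrite ltr_pwDr ?flat_gt0 ?flat_ge0//; lra.
Qed.

Lemma step_itv t : 0 <= step t <= 1.
Proof.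
rewrite divr_ge0 ?flat_ge0 ?(ltW (step_den t))//=.
by rewrite ler_pdivrMr ?step_den// mul1r lerDl flat_ge0.
Qed.

Lemma step0 t : t <= 0 -> step t = 0.
Proof. by move=> t0; rewrite /step {1}/flat ltNge t0 mul0r. Qed.

Lemma step1 t : 1 <= t -> step t = 1.
Proof.
move=> t1; rewrite /step [X in _ + X]/flat ltNge (_ : 1 - t <= 0); last lra.
by rewrite /= addr0 mulfV// gt_eqF// flat_gt0; lra.
Qed.

Definition bump c r x : R :=
  \prod_(i < n) (step (2 - (x 0 i - c 0 i) / r) * step (2 + (x 0 i - c 0 i) / r)).

Lemma smooth_prod (I : Type) (s : seq I) (F : I -> 'rV[R]_n -> R) :
  (forall i, smooth (F i)) -> smooth (fun x => \prod_(i <- s) F i x).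
Proof.
move=> sF; elim: s => [|i s IH].
  rewrite (_ : (fun x => _) = fun=> 1); first exact: smooth_cst.
  by apply/funext => x; rewrite big_nil.
rewrite (_ : (fun x => _) = fun x => F i x * \prod_(j <- s) F j x).
  exact: smoothM.
by apply/funext => x; rewrite big_cons.
Qed.

Lemma smooth_step a b i : smooth (fun x : 'rV[R]_n => step (a * x 0 i + b)).
Proof.
apply/smooth_exprP; apply: se_mul; first exact: se_flat.
apply: (@se_inv _ _ (fun x => flat 0 (a * x 0 i + b) + flat 0 (1 - (a * x 0 i + b)))).
  apply: se_add; first exact: se_flat.
  rewrite (_ : (fun x => _) = (fun x : 'rV[R]_n => flat 0 (- a * x 0 i + (1 - b)))).
    exact: se_flat.
  by apply/funext => x; congr flat; ring.
by move=> x; rewrite gt_eqF// step_den.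
Qed.

Lemma smooth_bump c r : smooth (bump c r).
Proof.
apply: smooth_prod => i; apply: smoothM.
  rewrite (_ : (fun x => _) =
    (fun x : 'rV[R]_n => step (- r^-1 * x 0 i + (2 + c 0 i / r)))).
    exact: smooth_step.
  by apply/funext => x; congr step; ring.
rewrite (_ : (fun x => _) =
  (fun x : 'rV[R]_n => step (r^-1 * x 0 i + (2 - c 0 i / r)))).
  exact: smooth_step.
by apply/funext => x; congr step; ring.
Qed.

Lemma bump_itv c r x : 0 <= bump c r x <= 1.
Proof.
have factor_itv i : 0 <= step (2 - (x 0 i - c 0 i) / r) *
    step (2 + (x 0 i - c 0 i) / r) <= 1.
  case/andP: (step_itv (2 - (x 0 i - c 0 i) / r)) => a0 a1.
  case/andP: (step_itv (2 + (x 0 i - c 0 i) / r)) => b0 b1.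
  by rewrite mulr_ge0//= mulr_ile1.
apply/andP; split; last by apply: prodr_ile1 => i _; exact: factor_itv.
by apply: prodr_ge0 => i _; case/andP: (factor_itv i).
Qed.

Lemma bump1 c r x : 0 < r -> `|x - c| <= r -> bump c r x = 1.
Proof.
move=> r0 xc; rewrite /bump big1// => i _.
have := le_trans (le_coord_norm (x - c) i) xc; rewrite !mxE.
rewrite ler_norml => /andP[lo up].
have t1 : (x 0 i - c 0 i) / r <= 1 by rewrite ler_pdivrMr// mul1r.
have t2 : -1 <= (x 0 i - c 0 i) / r by rewrite ler_pdivlMr// mulN1r.
by rewrite !step1 ?mulr1//; lra.
Qed.

Lemma bump_neq0 c r x : 0 < r -> bump c r x != 0 -> `|x - c| <= 2 * r.
Proof.
move=> r0; rewrite /bump prodf_seq_neq0 => /allP bx.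
apply: le_norm_coord => [|i]; first by rewrite mulr_ge0// ltW.
have /= := bx i (mem_index_enum i); rewrite mulf_eq0 negb_or !mxE => /andP[s1 s2].
rewrite ler_norml -ler_pdivrMr// -mulNr.
rewrite -[X in X && _](@ler_pdivlMr _ r)//.
apply/andP; split; rewrite leNgt; apply/negP => H.
  by move/eqP: s2; apply; apply: step0; lra.
by move/eqP: s1; apply; apply: step0; lra.
Qed.

(** Cover [C] by finitely many cubes whose doubles lie in [O]; with a bump [b_c]
    for each of them, take one minus the product of the [1 - b_c]. *)
Lemma cutoff (C O : set 'rV[R]_n) : compact C -> open O -> C `<=` O ->
  exists z, [/\ test_function O z, forall x, 0 <= z x <= 1 &
    exists V, [/\ open V, C `<=` V & forall x, V x -> z x = 1]].
Proof.
move=> cC oO CO.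
have /choice[r rP] (c : 'rV[R]_n) : exists r, 0 < r /\
    (C c -> forall x, `|x - c| <= 2 * r -> O x).
  have [Cc|nCc] := pselect (C c); last by exists 1.
  have /nbhs_ballP[e /= e0 eO] := oO _ (CO _ Cc).
  exists (e / 4); split => [|_ x xc]; first by rewrite divr_gt0.
  apply: eO; apply: rV_ball => // i; have := le_trans (le_coord_norm _ i) xc.
  by rewrite distrC !mxE => /le_lt_trans; apply; lra.
have cC' := cC; rewrite compact_cover in cC'.
have [] := cC' _ C (fun c => [set y : 'rV[R]_n | `|y - c| < r c]).
- by move=> c _; exact: norm_open_ball.
- by move=> x Cx; exists x => //=; rewrite subrr normr0; case: (rP x).
move=> D0 DC CD; pose D : seq 'rV[R]_n := finmap.enum_fset D0.
pose z x := 1 - \prod_(c <- D) (1 - bump c (r c) x).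
have b1 c x : 0 <= 1 - bump c (r c) x <= 1.
  by have /andP[] := bump_itv c (r c) x; lra.
have z01 x : 0 <= z x <= 1.
  suff : 0 <= \prod_(c <- D) (1 - bump c (r c) x) <= 1 by rewrite /z; lra.
  apply/andP; split; first by apply: prodr_ge0 => c _; case/andP: (b1 c x).
  by apply: prodr_ile1 => c _; exact: b1.
pose S := \big[setU/set0]_(c <- D) [set y : 'rV[R]_n | `|y - c| <= 2 * r c].
have cS : compact S by apply: bigsetU_compact => c _; exact: compact_norm_ball.
have zS x : z x != 0 -> S x.
  move=> zx; apply: contrapT => nS; move/eqP: zx; apply.
  rewrite /z big_seq big1 ?subrr// => c cD.
  suff -> : bump c (r c) x = 0 by rewrite subr0.
  apply/eqP; apply: contrapT => /negP /bump_neq0 bx; apply: nS.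
  rewrite /S -bigcup_seq; exists c => //; apply: bx.
  by case: (rP c).
have sS : supp z `<=` S.
  rewrite [X in _ `<=` X](closure_id _).1; last exact: compact_closed_rV.
  exact: closure_subset.
have SO : S `<=` O.
  rewrite /S -bigcup_seq => x [c /= cD xc].
  by have [_] := rP c; apply => //; apply: set_mem; exact: DC.
exists z; split => //.
- split.
  + have sb c : smooth (fun x => 1 + -1 * bump c (r c) x).
      by apply: smoothD; [|apply: smoothM]; [exact: smooth_cst..|exact: smooth_bump].
    rewrite (_ : z = fun x => 1 + -1 * \prod_(c <- D) (1 + -1 * bump c (r c) x)).
      apply: smoothD; [exact: smooth_cst|apply: smoothM; first exact: smooth_cst].
      exact: smooth_prod.
    apply/funext => x; rewrite /z mulN1r; congr (_ - _).
    by apply: eq_bigr => c _; rewrite mulN1r.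
  + by apply: subclosed_compact cS sS; exact: closed_closure.
  + exact: subset_trans SO.
exists (\bigcup_(c in [set` D]) [set y : 'rV[R]_n | `|y - c| < r c]); split => //.
  by apply: bigcup_open => c _; exact: norm_open_ball.
move=> x [c /= cD xc]; rewrite /z (big_rem c)//= bump1 ?subrr ?mul0r ?subr0//.
  by case: (rP c).
exact: ltW.
Qed.

End cutoff.

(** * The fundamental lemma of the calculus of variations *)

Section local_integrals.
Context (R : realType) (n : nat).
Notation mu := (@lebn R n).
Implicit Types (f g h : 'rV[R]_n -> R) (U V S C : set 'rV[R]_n).

Lemma continuous_measurable_lebn h D : continuous h -> measurable_fun D h.
Proof.
move=> ch mD; apply: (measurability _ (RGenOInfty.measurableE R)) => //.
move=> _ [_ [a ->] <-]; apply: measurableI => //; apply: open_measurable_lebn.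
by apply: open_comp; [move=> x _; exact: ch|exact: interval_open].
Qed.

Lemma patch0_supp U S f : S `<=` U -> (forall x, U x -> ~ S x -> f x = 0) ->
  f \_ U = f \_ S.
Proof.
move=> SU f0; apply/funext => x; rewrite /patch; case: ifPn => [|/negP] xU.
  by case: ifPn => // /negP xS; apply: f0; [exact: set_mem|by move=> /mem_set].
by case: ifPn => // /set_mem/SU/mem_set.
Qed.

Lemma Rintegral_supp U S f : S `<=` U -> (forall x, U x -> ~ S x -> f x = 0) ->
  \int[mu]_(x in U) f x = \int[mu]_(x in S) f x.
Proof.
by move=> SU f0; rewrite Rintegral_mkcond (patch0_supp SU f0) -Rintegral_mkcond.
Qed.

Lemma integrable_supp U S f : measurable U -> measurable S ->
  S `<=` U -> (forall x, U x -> ~ S x -> f x = 0) ->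
  mu.-integrable S (EFin \o f) -> mu.-integrable U (EFin \o f).
Proof.
move=> mU mS SU f0 /(integrable_mkcond _ mS); rewrite restrict_EFin.
by rewrite -(patch0_supp SU f0) -restrict_EFin => /(integrable_mkcond _ mU).
Qed.

Lemma bounded_on_compact h S : continuous h -> compact S ->
  [bounded h x | x in S].
Proof.
move=> ch cS; have : compact (h @` S).
  by apply: continuous_compact => //; apply: continuous_subspaceT.
move=> /compact_bounded[M [Mr MP]]; exists M; split => // x Mx y Sy.
by apply: (MP x Mx); exists y.
Qed.

Lemma integrable_loc_mul U f h S : loc_integrable U f -> continuous h ->
  compact S -> S `<=` U -> mu.-integrable S (EFin \o (fun x => f x * h x)).
Proof.
move=> [_ lf] ch cS SU.
have mS := compact_measurable_lebn cS.
have := integrableMl mS (lf _ cS SU) (@continuous_measurable_lebn h S ch)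
  (bounded_on_compact ch cS).
by apply: eq_integrable => // x _ /=; rewrite EFinM.
Qed.

Lemma test_integrable U f h : open U -> loc_integrable U f -> continuous h ->
  compact (supp h) -> supp h `<=` U ->
  mu.-integrable U (EFin \o (fun x => f x * h x)).
Proof.
move=> oU lf ch cS SU; apply: (@integrable_supp U (supp h)) => //.
- exact: open_measurable_lebn.
- exact: compact_measurable_lebn.
- move=> x _ nS; rewrite (_ : h x = 0) ?mulr0//; apply: contrapT => /eqP hx.
  by apply: nS; exact: subset_closure.
- exact: (integrable_loc_mul lf).
Qed.

Lemma not_supp h x : ~ supp h x -> h x = 0.
Proof.
by move=> nS; apply: contrapT => /eqP hx; apply: nS; exact: subset_closure.
Qed.

End local_integrals.

Section fundamental_lemma.
Context (R : realType) (n : nat).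
Notation mu := (@lebn R n).
Implicit Types (f g h : 'rV[R]_n -> R) (U V S C : set 'rV[R]_n).

(** Test with cutoffs of [C] in shrinking neighbourhoods of it, multiplied by a
    fixed cutoff in [V]: they converge to the indicator of [C] with supports in
    one compact set, and dominated convergence applies. *)
Lemma integral_compact0 V g : open V -> loc_integrable V g ->
  (forall psi, test_function V psi -> \int[mu]_(x in V) (g x * psi x) = 0) ->
  forall C, compact C -> C `<=` V -> (\int[mu]_(x in C) (g x)%:E = 0)%E.
Proof.
move=> oV lg g0 C cC CV.
have [z0 [[sz0 cz0 z0V] z001 [V0 [oV0 CV0 z01]]]] := cutoff cC oV CV.
set K := supp z0 in cz0 z0V.
have CK : C `<=` K.
  by move=> x /CV0/z01 zx; apply: subset_closure; rewrite /= zx oner_neq0.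
pose N m := \bigcup_(c in C) [set y : 'rV[R]_n | `|y - c| < m.+1%:R^-1].
have oN m : open (N m) by apply: bigcup_open => c _; exact: norm_open_ball.
have CN m : C `<=` N m by move=> x Cx; exists x => //=; rewrite subrr normr0.
have /choice[z zP] m := cutoff cC (oN m) (@CN m).
have mK := compact_measurable_lebn cz0.
have mC := compact_measurable_lebn cC.
pose F m x : \bar R := (g x * (z0 x * z m x))%:E.
have szz m : smooth (fun x => z0 x * z m x).
  by apply: smoothM => //; have [[]] := zP m.
have suppK m : supp (fun x => z0 x * z m x) `<=` K.
  apply: closure_subset => x /=; apply: contra_neq => ->.
  by rewrite mul0r.
have F0 m : (\int[mu]_(x in K) F m x = 0)%E.
  have tm : test_function V (fun x => z0 x * z m x).
    split => //; last by apply: subset_trans (suppK m) _.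
    by apply: subclosed_compact cz0 (suppK m); exact: closed_closure.
  have := g0 _ tm; rewrite (@Rintegral_supp _ _ _ K)//; last first.
    by move=> x _ /not_supp ->; rewrite mul0r mulr0.
  have /integrable_fin_num := integrable_loc_mul lg (smooth_continuous (szz m)) cz0 z0V.
  by move=> /(_ mK) /fineK <- int0; congr (_%:E); exact: int0.
have lim x : K x -> F m x @[m --> \oo] --> ((g x)%:E * (\1_C x)%:E)%E.
  move=> Kx; have [Cx|nCx] := pselect (C x).
    rewrite indicE mem_set// mule1.
    apply: cvg_near_cst; apply: nearW => m.
    rewrite /F z01; last exact: CV0.
    have [_ _ [W [_ CW W1]]] := zP m.
    by rewrite W1 ?mulr1//; exact: CW.
  rewrite indicE memNset// mule0.
  have : open (~` C) by apply: closed_openC; exact: compact_closed_rV.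
  move=> /(_ x nCx) /nbhs_ballP[e /= e0 eC].
  apply: cvg_near_cst; near=> m.
  rewrite /F (_ : z m x = 0) ?mulr0//.
  have [[_ _ zN] _ _] := zP m.
  apply: not_supp => /zN[c Cc /= xc]; apply: (eC c) => //.
  apply: rV_ball => // i; have := le_lt_trans (le_coord_norm _ i) xc.
  rewrite !mxE => /lt_trans; apply.
  near: m; exact: (near_infty_natSinv_lt (PosNum e0)).
have lK := lg.2 _ cz0 z0V.
have [] := @dominated_convergence _ _ _ mu K mK F
  (fun x => (g x)%:E * (\1_C x)%:E)%E (abse \o (EFin \o g)).
- move=> m; apply/measurable_EFinP.
  apply: measurable_funM; last exact/continuous_measurable_lebn/smooth_continuous.
  by apply/measurable_EFinP; case/integrableP: lK.
- apply: emeasurable_funM; first by case/integrableP: lK.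
  by apply/measurable_EFinP; exact: measurable_indic.
- exact: aeW.
- exact: integrable_abse.
- apply: aeW => x m Kx; rewrite /F /= lee_fin normrM ler_piMr//.
  have [_ z01m _] := zP m.
  have /andP[? ?] := z001 x; have /andP[? ?] := z01m x.
  by rewrite ger0_norm ?mulr_ge0// mulr_ile1.
move=> _ _ cv.
have cv0 : [sequence (\int[mu]_(x in K) F m x)%E]_m @ \oo --> (0 : \bar R).
  rewrite (_ : [sequence _]_m = cst 0%E); first exact: cvg_cst.
  exact/funext.
have <- := cvg_unique (@ereal_hausdorff R) cv cv0.
rewrite -[in LHS](setIidr CK) integral_mkcondr; apply: eq_integral => x _.
by rewrite patchE indicE; case: ifPn => _; rewrite ?mule1 ?mule0.
Unshelve. all: by end_near. Qed.

(** Otherwise inner regularity gives a compact set of positive measure on which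
    [g] is positive, hence has a positive integral. *)
Lemma compact_integral0_pos V g : open V -> loc_integrable V g ->
  (forall C, compact C -> C `<=` V -> (\int[mu]_(x in C) (g x)%:E = 0)%E) ->
  lebn [set x | V x /\ 0 < g x] = 0%E.
Proof.
move=> oV lg g0; apply/eqP/negPn/negP => E0.
have mV := open_measurable_lebn oV.
have mE : measurable [set x | V x /\ 0 < g x].
  rewrite (_ : mkset _ = V `&` g @^-1` `]0, +oo[).
    exact: lg.1.
  by apply/seteqP; split => x /=; rewrite in_itv /= andbT.
have [C [cC CE /eqP C0]] := lebn_inner_regular mE E0.
have CV : C `<=` V by move=> x /CE[].
have mC := compact_measurable_lebn cC.
apply: C0; have := g0 C cC CV.
have lC := lg.2 _ cC CV.
have -> : (\int[mu]_(x in C) (g x)%:E = \int[mu]_(x in C) `|(g x)%:E|)%E.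
  apply: eq_integral => x /set_mem/CE[_ gx].
  by rewrite /= ger0_norm// ltW.
move=> /(@ae_eq_integral_abs _ _ _ mu C mC (EFin \o g)).
have mg : measurable_fun C (EFin \o g) by case/integrableP: lC.
move=> /(_ mg) h; apply/negligible_lebn; apply: negligibleS h => x Cx /= /(_ Cx).
have [_ gx] := CE x Cx.
by move=> [g00]; move: gx; rewrite g00 ltxx.
Qed.

Lemma fundamental_lemma V g : open V -> loc_integrable V g ->
  (forall psi, test_function V psi -> \int[mu]_(x in V) (g x * psi x) = 0) ->
  {ae mu, forall x, V x -> g x = 0}.
Proof.
move=> oV lg /(integral_compact0 oV lg) g0.
have p := compact_integral0_pos oV lg g0.
have q : lebn [set x | V x /\ 0 < - g x] = 0%E.
  apply: compact_integral0_pos => //.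
    split; first by apply: measurableT_comp lg.1; exact: oppr_measurable.
    move=> K cK KV; have := integrableN (lg.2 K cK KV).
    by [].
  move=> C cC CV; under eq_integral do rewrite EFinN.
  rewrite integralN ?g0 ?oppe0//.
  apply: integrable_add_def; first exact: compact_measurable_lebn.
  exact: lg.2.
have := negligibleU (proj2 (negligible_lebn _) p) (proj2 (negligible_lebn _) q).
apply: negligibleS => x /= /not_implyP[Vx /eqP gx].
rewrite neq_lt in gx; case/orP: gx => gx; [right|left]; split => //.
by rewrite oppr_gt0.
Qed.

End fundamental_lemma.

(** * Calculus of weak derivatives *)

Section essentially_bounded.
Context (R : realType) (n : nat).
Notation mu := (@lebn R n).
Implicit Types (f g h : 'rV[R]_n -> R) (U V S C : set 'rV[R]_n).

Lemma ess_sup_on_leP U h (y : \bar R) :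
  (ess_sup_on U h <= y)%E <-> {ae mu, forall x, U x -> ((h x)%:E <= y)%E}.
Proof.
split=> [/ess_supP|hy].
  apply: filterS => x; rewrite /patch => + Ux.
  by rewrite mem_set.
apply/ess_supP; apply: filterS hy => x; rewrite /patch => hx.
by case: ifPn => [/set_mem/hx//|_]; rewrite leNye.
Qed.

Lemma LinftyP U f : Linfty U f <-> measurable_fun U f /\
  exists M, {ae mu, forall x, U x -> `|f x| <= M}.
Proof.
split=> -[mf fM]; split => //; last first.
  have [M MP] := fM; apply: le_lt_trans (ltry M).
  by apply/ess_sup_on_leP; apply: filterS MP => x + Ux; rewrite lee_fin; apply.
have := ess_sup_ge mu (patch (cst -oo%E) U (EFin \o (fun x => `|f x|))).
rewrite -/(ess_sup_on U _); move: fM.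
case: (ess_sup_on U _) => [M|//|] _ fM; [exists M|exists 0]; apply: filterS fM => x.
  by rewrite /patch => + Ux; rewrite mem_set.
by rewrite /patch => + Ux; rewrite mem_set//= leeNy_eq.
Qed.

Lemma LinftyS U V f : measurable U -> V `<=` U -> Linfty U f -> Linfty V f.
Proof.
move=> mU VU /LinftyP[mf [M fM]]; apply/LinftyP; split.
  exact: measurable_funS mf.
by exists M; apply: filterS fM => x + /VU; exact.
Qed.

Lemma LinftyD U f g : Linfty U f -> Linfty U g -> Linfty U (fun x => f x + g x).
Proof.
move=> /LinftyP[mf [M fM]] /LinftyP[mg [M' gM]]; apply/LinftyP; split.
  exact: measurable_funD.
exists (M + M'); move: fM gM; apply: filterS2 => x fx gx Ux.
by apply: le_trans (ler_normD _ _) _; apply: lerD; [exact: fx|exact: gx].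
Qed.

Lemma LinftyM U f h M : continuous h -> (forall x, `|h x| <= M) ->
  Linfty U f -> Linfty U (fun x => h x * f x).
Proof.
move=> ch hM /LinftyP[mf [M' fM]]; apply/LinftyP; split.
  by apply: measurable_funM => //; exact: continuous_measurable_lebn.
exists (M * M'); apply: filterS fM => x fx Ux.
by rewrite normrM ler_pM//; exact: fx.
Qed.

Lemma LinftyZ U f c : Linfty U f -> Linfty U (fun x => c * f x).
Proof. by apply: (@LinftyM _ _ (fun=> c) `|c|) => //; exact: cst_continuous. Qed.

Lemma loc_integrableS U V f : measurable U -> V `<=` U ->
  loc_integrable U f -> loc_integrable V f.
Proof.
move=> mU VU [mf lf]; split; first exact: measurable_funS mf.
by move=> K cK KV; apply: lf => //; exact: subset_trans VU.
Qed.

Lemma loc_integrableD U f g : loc_integrable U f -> loc_integrable U g ->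
  loc_integrable U (fun x => f x + g x).
Proof.
move=> [mf lf] [mg lg]; split; first exact: measurable_funD.
move=> K cK KU; have mK := compact_measurable_lebn cK.
exact: (integrableD mK (lf K cK KU) (lg K cK KU)).
Qed.

Lemma loc_integrableZ U f c : loc_integrable U f ->
  loc_integrable U (fun x => c * f x).
Proof.
move=> [mf lf]; split; first by apply: measurable_funM => //; exact: measurable_cst.
move=> K cK KU; have mK := compact_measurable_lebn cK.
exact: (integrableZl mK c (lf K cK KU)).
Qed.

Lemma Linfty_loc_integrable U f : measurable U -> Linfty U f -> loc_integrable U f.
Proof.
move=> mU /LinftyP[mf [M fM]]; split => // K cK KU.
have mK := compact_measurable_lebn cK.
have mfK : measurable_fun K f by exact: measurable_funS mf.
have Koo : (lebn K < +oo)%E.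
  by apply: lebn_bounded; exact: compact_bounded.
apply/integrableP; split; first exact/measurable_EFinP.
apply: (@le_lt_trans _ _ (\int[mu]_(x in K) (cst `|M|%:E x))%E); last first.
  by rewrite integral_cst// lte_mul_pinfty.
apply: ae_ge0_le_integral => //.
- by apply/measurable_EFinP; apply: measurableT_comp mfK; exact: normr_measurable.
- by move=> x _; rewrite lee_fin.
apply: filterS fM => x fx Kx; rewrite lee_fin.
by apply: le_trans (fx (KU _ Kx)) _; exact: ler_norm.
Qed.

Lemma eq_ae_Rintegral U f g : measurable U -> measurable_fun U f ->
  measurable_fun U g -> {ae mu, forall x, U x -> f x = g x} ->
  \int[mu]_(x in U) f x = \int[mu]_(x in U) g x.
Proof.
move=> mU mf mg fg; congr fine; apply: ae_eq_integral => //.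
- exact/measurable_EFinP.
- exact/measurable_EFinP.
by apply: filterS fg => x /= h /h ->.
Qed.

End essentially_bounded.

Section weak_derivatives.
Context (R : realType) (n : nat).
Notation mu := (@lebn R n).
Implicit Types (f g h z psi : 'rV[R]_n -> R) (U V S C : set 'rV[R]_n).
Implicit Types (s : seq 'I_n).

Lemma test_functionS U V psi : U `<=` V -> test_function U psi -> test_function V psi.
Proof. by move=> UV [? ? sU]; split => //; exact: subset_trans UV. Qed.

Lemma test_pderiv U s psi : test_function U psi -> test_function U (pderiv s psi).
Proof.
move=> [sp cp pU]; split; first exact: smooth_pderiv.
  by apply: subclosed_compact cp (@supp_pderiv _ _ _ _); exact: closed_closure.
by apply: subset_trans pU; exact: supp_pderiv.
Qed.

Lemma supp_mull z psi : supp (fun x => z x * psi x) `<=` supp z.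
Proof.
by apply: closure_subset => x /=; apply: contra_neq => ->; rewrite mul0r.
Qed.

Lemma supp_mulr z psi : supp (fun x => z x * psi x) `<=` supp psi.
Proof.
by apply: closure_subset => x /=; apply: contra_neq => ->; rewrite mulr0.
Qed.

Lemma test_mull U z psi : test_function U z -> smooth psi ->
  test_function U (fun x => z x * psi x).
Proof.
move=> [sz cz zU] sp; split; first exact: smoothM.
  by apply: subclosed_compact cz (@supp_mull _ _); exact: closed_closure.
by apply: subset_trans zU; exact: supp_mull.
Qed.

Lemma test_mulr U z psi : smooth z -> test_function U psi ->
  test_function U (fun x => z x * psi x).
Proof.
move=> sz [sp cp pU]; split; first exact: smoothM.
  by apply: subclosed_compact cp (@supp_mulr _ _); exact: closed_closure.
by apply: subset_trans pU; exact: supp_mulr.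
Qed.

Lemma test_integrable_mul U f psi : open U -> loc_integrable U f ->
  test_function U psi -> mu.-integrable U (EFin \o (fun x => f x * psi x)).
Proof.
move=> oU lf [sp cp pU]; apply: test_integrable => //; exact: smooth_continuous.
Qed.

(** Integrals against a test function of [V] may be taken over any larger set,
    which is why weak derivatives restrict to smaller open sets. *)
Lemma Rintegral_test U V f psi : V `<=` U -> test_function V psi ->
  \int[mu]_(x in U) (f x * psi x) = \int[mu]_(x in V) (f x * psi x).
Proof.
move=> VU [_ _ pV]; apply: Rintegral_supp => // x _ nV.
by rewrite (not_supp (h := psi)) ?mulr0// => /pV.
Qed.

Lemma is_weak_derivS U V s f g : open U -> V `<=` U ->
  is_weak_deriv U s f g -> is_weak_deriv V s f g.
Proof.
move=> oU VU [lf lg fg]; have mU := open_measurable_lebn oU.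
split; [exact: loc_integrableS lf|exact: loc_integrableS lg|].
move=> psi tp; rewrite -(Rintegral_test f VU (test_pderiv s tp)).
by rewrite -(Rintegral_test g VU tp) fg//; exact: test_functionS tp.
Qed.

(** On [V] the difference of the two weak derivatives integrates to zero against
    every test function, since the functions themselves agree there. *)
Lemma weak_deriv_local_unique U V s f1 f2 g1 g2 : open U -> open V -> V `<=` U ->
  is_weak_deriv U s f1 g1 -> is_weak_deriv U s f2 g2 ->
  {ae mu, forall x, V x -> f1 x = f2 x} ->
  {ae mu, forall x, V x -> g1 x = g2 x}.
Proof.
move=> oU oV VU /(is_weak_derivS oU VU)[lf1 lg1 fg1].
move=> /(is_weak_derivS oU VU)[lf2 lg2 fg2] f12.
have mV := open_measurable_lebn oV.
have lg : loc_integrable V (fun x => g1 x + -1 * g2 x).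
  by apply: loc_integrableD; [exact: lg1|exact: loc_integrableZ lg2].
have : {ae mu, forall x, V x -> g1 x + -1 * g2 x = 0}.
  apply: fundamental_lemma => // psi tp.
  have i1 := test_integrable_mul oV lg1 tp.
  have i2 := test_integrable_mul oV lg2 tp.
  under eq_Rintegral => x _ do rewrite mulrDl mulN1r mulNr.
  rewrite RintegralB//; apply/eqP; rewrite subr_eq0; apply/eqP.
  apply: (@mulfI _ ((-1) ^+ size s)); first by rewrite signr_eq0.
  rewrite -(fg1 _ tp) -(fg2 _ tp); apply: eq_ae_Rintegral; first exact: mV.
  - apply: measurable_funM; first exact: lf1.1.
    by apply/continuous_measurable_lebn/smooth_continuous/smooth_pderiv; case: tp.
  - apply: measurable_funM; first exact: lf2.1.
    by apply/continuous_measurable_lebn/smooth_continuous/smooth_pderiv; case: tp.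
  by apply: filterS f12 => x h /h ->.
apply: filterS => x h Vx; apply/eqP; rewrite -subr_eq0.
by rewrite -[- g2 x]mulN1r h.
Qed.

Lemma is_weak_derivD U s f1 f2 g1 g2 : open U ->
  is_weak_deriv U s f1 g1 -> is_weak_deriv U s f2 g2 ->
  is_weak_deriv U s (fun x => f1 x + f2 x) (fun x => g1 x + g2 x).
Proof.
move=> oU [lf1 lg1 fg1] [lf2 lg2 fg2]; have mU := open_measurable_lebn oU.
split; [exact: loc_integrableD|exact: loc_integrableD|].
move=> psi tp; have tps := test_pderiv s tp.
under eq_Rintegral => x _ do rewrite mulrDl.
under [in RHS]eq_Rintegral => x _ do rewrite mulrDl.
by rewrite !RintegralD ?mulrDr ?fg1 ?fg2//; exact: test_integrable_mul.
Qed.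

Lemma is_weak_derivZ U s f g c : open U -> is_weak_deriv U s f g ->
  is_weak_deriv U s (fun x => c * f x) (fun x => c * g x).
Proof.
move=> oU [lf lg fg]; have mU := open_measurable_lebn oU.
split; [exact: loc_integrableZ|exact: loc_integrableZ|].
move=> psi tp; have tps := test_pderiv s tp.
under eq_Rintegral => x _ do rewrite -mulrA.
under [in RHS]eq_Rintegral => x _ do rewrite -mulrA.
by rewrite !RintegralZl ?fg 1?mulrCA//; exact: test_integrable_mul.
Qed.

(** The scalar version of [sobolev], to which it reduces componentwise. *)
Definition sobolev1 k U f := Linfty U f /\ forall s, (size s <= k)%N ->
  exists2 g, is_weak_deriv U s f g & Linfty U g.

Lemma sobolev1_pred k U f : sobolev1 k.+1 U f -> sobolev1 k U f.
Proof. by move=> [Lf df]; split => // s sk; apply: df; exact: leqW. Qed.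

Lemma sobolev1S k U V f : open U -> V `<=` U -> sobolev1 k U f -> sobolev1 k V f.
Proof.
move=> oU VU [Lf df]; have mU := open_measurable_lebn oU.
split; first exact: LinftyS Lf.
move=> s sk; have [g fg Lg] := df s sk.
by exists g; [exact: is_weak_derivS fg|exact: LinftyS Lg].
Qed.

Lemma sobolev1D k U f g : open U -> sobolev1 k U f -> sobolev1 k U g ->
  sobolev1 k U (fun x => f x + g x).
Proof.
move=> oU [Lf df] [Lg dg]; split; first exact: LinftyD.
move=> s sk; have [f' ff' Lf'] := df s sk; have [g' gg' Lg'] := dg s sk.
by exists (fun x => f' x + g' x); [exact: is_weak_derivD|exact: LinftyD].
Qed.

Lemma sobolev1Z k U f c : open U -> sobolev1 k U f ->
  sobolev1 k U (fun x => c * f x).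
Proof.
move=> oU [Lf df]; split; first exact: LinftyZ.
move=> s sk; have [f' ff' Lf'] := df s sk.
by exists (fun x => c * f' x); [exact: is_weak_derivZ|exact: LinftyZ].
Qed.

(** The list of directions is consumed from its head, both by [pderiv] and here:
    testing [g] against [pderiv s psi] tests [f] against [pderiv (i :: s) psi]. *)
Lemma sobolev1_deriv k U f g i : open U -> sobolev1 k.+1 U f ->
  is_weak_deriv U [:: i] f g -> Linfty U g -> sobolev1 k U g.
Proof.
move=> oU [Lf df] [lf lg fg] Lg; split => // s sk.
have [g' [_ lg' fg'] Lg'] := df (i :: s) sk.
exists g' => //; split => // psi tp.
have := fg _ (test_pderiv s tp); rewrite /= expr1 mulN1r => /(congr1 -%R).
by rewrite opprK => <-; rewrite fg'//= exprS mulN1r mulNr opprK.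
Qed.

Lemma is_weak_deriv_nil U f : loc_integrable U f -> is_weak_deriv U [::] f f.
Proof. by move=> lf; split => // psi _; rewrite expr0 mul1r. Qed.

Lemma bounded_test z : smooth z -> compact (supp z) -> exists M, forall x, `|z x| <= M.
Proof.
move=> sz cz; have [M [_ MP]] := bounded_on_compact (smooth_continuous sz) cz.
exists (`|M| + 1) => x; have [zx|nzx] := pselect (supp z x); last first.
  by rewrite (not_supp nzx) normr0 addr_ge0.
by apply: MP => //; apply: le_lt_trans (ler_norm M) _; rewrite ltrDl.
Qed.

(** The Leibniz rule, by induction on the order: for a test function [psi] and
    [chi := pderiv s psi], the product [z * D_i chi] is [D_i (z * chi)] minus
    [D_i z * chi], so [D_i (z f)] is [z * D_i f + D_i z * f], both terms of which
    have one derivative less to take. *)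
Lemma sobolev1M k U f z : open U -> smooth z -> compact (supp z) ->
  sobolev1 k U f -> sobolev1 k U (fun x => z x * f x).
Proof.
move=> oU; have mU := open_measurable_lebn oU.
elim: k f z => [|k IH] f z sz cz Wf.
  have [Lf _] := Wf; have [M zM] := bounded_test sz cz.
  have Lzf := LinftyM (smooth_continuous sz) zM Lf.
  split; first exact: Lzf.
  move=> [|//] _; exists (fun x => z x * f x); last exact: Lzf.
  by apply: is_weak_deriv_nil; exact: Linfty_loc_integrable.
have [Lf df] := Wf; have [M zM] := bounded_test sz cz.
have Lzf := LinftyM (smooth_continuous sz) zM Lf.
split; first exact: Lzf.
move=> [_|i s sk].
  exists (fun x => z x * f x); last exact: Lzf.
  by apply: is_weak_deriv_nil; exact: Linfty_loc_integrable.
have [f1 ff1 Lf1] := df [:: i] isT.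
have Wf1 := sobolev1_deriv oU Wf ff1 Lf1.
have tz : test_function setT z by split.
have [sz' cz' _] := test_pderiv [:: i] tz.
have [_ /(_ s sk)[G1 [l1 _ zG1] LG1]] := IH f1 z sz cz Wf1.
have [_ /(_ s sk)[G2 [l2 _ zG2] LG2]] := IH f _ sz' cz' (sobolev1_pred Wf).
have LG := LinftyD LG1 LG2.
exists (fun x => G1 x + G2 x); last exact: LG.
split.
- exact: Linfty_loc_integrable.
- exact: Linfty_loc_integrable.
move=> psi tp; have tps := test_pderiv s tp.
have [sp _ _] := tps.
have lf := Linfty_loc_integrable mU Lf.
set chi := pderiv s psi in tps sp.
have tzchi : test_function U (fun x => z x * chi x) by exact: test_mulr.
have tz'chi : test_function U (fun x => pderiv [:: i] z x * chi x) by exact: test_mulr.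
have iG1 := test_integrable_mul oU (Linfty_loc_integrable mU LG1) tp.
have iG2 := test_integrable_mul oU (Linfty_loc_integrable mU LG2) tp.
under [in RHS]eq_Rintegral => x _ do rewrite mulrDl.
rewrite RintegralD// mulrDr [size (i :: s)]/= exprS -!mulrA -zG1// -zG2//.
rewrite -/chi.
transitivity (\int[mu]_(x in U) (f x * pderiv [:: i] (fun x => z x * chi x) x)
   - \int[mu]_(x in U) (f x * (pderiv [:: i] z x * chi x))).
  rewrite -RintegralB//; last 2 first.
  - exact: test_integrable_mul (test_pderiv [:: i] tzchi).
  - exact: test_integrable_mul.
  apply: eq_Rintegral => x _; rewrite pderiv1M//.
  rewrite -[pderiv (i :: s) psi]/(pderiv [:: i] chi); ring.
have [_ _ ->//] := ff1.
rewrite /= expr1 !mulN1r; congr (- _ - _).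
  by apply: eq_Rintegral => x _; ring.
by apply: eq_Rintegral => x _; ring.
Qed.

(** With a cutoff [eta] in [U] that is 1 near [K], a test function [psi] of [W]
    may be replaced by the test function [eta * psi] of [U]; the extension by
    zero of [eta * g] is then the weak derivative, for [g] that of [f]. *)
Lemma sobolev1_extend k U W K f : open U -> open W -> U `<=` W ->
  compact K -> K `<=` U -> {ae mu, forall x, (U `\` K) x -> f x = 0} ->
  sobolev1 k U f -> sobolev1 k W (patch (fun=> 0) U f).
Proof.
move=> oU oW UW cK KU f0 [Lf df].
have mU := open_measurable_lebn oU; have mW := open_measurable_lebn oW.
have LW g : Linfty U g -> Linfty W (patch (fun=> 0) U g).
  move=> /LinftyP[mg [M gM]]; apply/LinftyP; split.
    by apply/measurable_restrict => //; rewrite setIidr.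
  exists `|M|; apply: filterS gM => x gx _; rewrite /patch.
  case: ifPn => [/set_mem/gx /le_trans|_]; last by rewrite normr0.
  by apply; exact: ler_norm.
split; first exact: LW.
move=> s sk; have [g [lf lg fg] Lg] := df s sk.
have [eta [[seta ceta etaU] _ [V [oV KV eta1]]]] := cutoff cK oU KU.
have [M etaM] := bounded_test seta ceta.
have Leg := LinftyM (smooth_continuous seta) etaM Lg.
exists (patch (fun=> 0) U (fun x => eta x * g x)); last exact: LW.
split; [exact/Linfty_loc_integrable/LW|exact/Linfty_loc_integrable/LW|].
move=> psi [sp cp pW].
have patch_int (h q : 'rV[R]_n -> R) :
    \int[mu]_(x in W) (patch (fun=> 0) U h x * q x) = \int[mu]_(x in U) (h x * q x).
  rewrite (@Rintegral_supp _ _ W U)//; last first.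
    by move=> x _ nUx; rewrite /patch memNset// mul0r.
  by apply: eq_Rintegral => x Ux; rewrite /patch Ux.
rewrite !patch_int.
have te : test_function U (fun x => eta x * psi x) by exact: test_mull.
transitivity (\int[mu]_(x in U) (f x * pderiv s (fun x => eta x * psi x) x)).
  have mf := Lf.1.
  apply: eq_ae_Rintegral; first exact: mU.
  - apply: measurable_funM; first exact: mf.
    exact/continuous_measurable_lebn/smooth_continuous/smooth_pderiv.
  - apply: measurable_funM; first exact: mf.
    apply/continuous_measurable_lebn/smooth_continuous/smooth_pderiv.
    exact: smoothM.
  apply: filterS f0 => x f0 Ux; have [Kx|nKx] := pselect (K x); last first.
    by rewrite f0// !mul0r.
  congr (_ * _); apply: (pderiv_local s oV) => [y Vy|]; last exact: KV.
  by rewrite eta1// mul1r.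
by rewrite fg//; congr (_ * _); apply: eq_Rintegral => x _; ring.
Qed.

End weak_derivatives.

(** * Euclidean norm, essential limsup and jets *)

Section euclidean_norm.
Context (R : realType) (n : nat).
Implicit Types x y : 'rV[R]_n.

Lemma enorm_ge0 x : 0 <= enorm x.
Proof. exact: sqrtr_ge0. Qed.

Lemma norm_le_enorm x : `|x| <= enorm x.
Proof.
apply: le_norm_coord => [|i]; first exact: enorm_ge0.
rewrite -(sqrtr_sqr (x 0 i)) /enorm ler_sqrt; last first.
  by apply: sumr_ge0 => j _; exact: sqr_ge0.
by rewrite (bigD1 i)//= lerDl; apply: sumr_ge0 => j _; exact: sqr_ge0.
Qed.

Lemma enorm_le_norm x : enorm x <= Num.sqrt n%:R * `|x|.
Proof.
rewrite -[X in _ * X]ger0_norm// -sqrtr_sqr -sqrtrM// /enorm ler_wsqrtr//.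
rewrite mulr_natl -[X in _ *+ X]card_ord -sumr_const; apply: ler_sum => i _.
by rewrite -[leLHS]real_normK ?num_real// lerXn2r ?nnegrE//; exact: le_coord_norm.
Qed.

Lemma enormZ c x : enorm (c *: x) = `|c| * enorm x.
Proof.
rewrite /enorm -sqrtr_sqr -sqrtrM ?sqr_ge0//; congr Num.sqrt.
by rewrite mulr_sumr; apply: eq_bigr => i _; rewrite mxE exprMn.
Qed.

Lemma enorm_continuous : continuous (@enorm R n).
Proof.
move=> x; apply: (@continuous_comp _ _ _ (fun x : 'rV[R]_n => \sum_(i < n) x 0 i ^+ 2)
  Num.sqrt); last exact: sqrt_continuous.
apply: (@continuous_big R _ +%R 0 xpredT _ _ (index_enum 'I_n)
    (fun i x => x 0 i ^+ 2)) => [y|i _].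
  by apply: cvgD; [exact: cvg_fst|exact: cvg_snd].
rewrite (_ : (fun x => _) = (fun x : 'rV[R]_n => x 0 i * x 0 i)).
  by apply: continuous_mulf; exact: coord_continuous.
by apply/funext => y; rewrite expr2.
Qed.

Lemma open_eball x e : open (eball x e).
Proof.
rewrite (_ : eball x e = (fun y => enorm (y - x)) @^-1` [set s : R | s < e])//.
apply: open_comp; last exact: open_lt.
move=> y _; apply: (@continuous_comp _ _ _ (fun y => y - x) (@enorm R n)).
  by apply: continuousB => //; exact: cst_continuous.
exact: enorm_continuous.
Qed.

Lemma eball_center x e : 0 < e -> eball x e x.
Proof.
by move=> e0; rewrite /eball /= subrr -[X in enorm X](scale0r x) enormZ normr0 mul0r.
Qed.

End euclidean_norm.

Section essential_limsup.
Context (R : realType) (n : nat).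
Notation mu := (@lebn R n).
Implicit Types (h : 'rV[R]_n -> R) (U V : set 'rV[R]_n).

Lemma ess_sup_onS U V h : U `<=` V -> (ess_sup_on U h <= ess_sup_on V h)%E.
Proof.
move=> UV; apply/ess_sup_on_leP.
have /ess_sup_on_leP := lexx (ess_sup_on V h).
by apply: filterS => x hx /UV.
Qed.

Lemma eq_ess_sup_on U h1 h2 : {ae mu, forall x, U x -> h1 x = h2 x} ->
  (ess_sup_on U h1 <= ess_sup_on U h2)%E.
Proof.
move=> h12; apply/ess_sup_on_leP.
have /ess_sup_on_leP := lexx (ess_sup_on U h2).
by move: h12; apply: filterS2 => x h12 hx Ux; rewrite h12//; exact: hx.
Qed.

(** The essential suprema over shrinking balls decrease. *)
Lemma ess_limsupE U h x : ess_limsup U h x =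
  ereal_inf [set ess_sup_on (eball x e `&` U) h | e in `]0, +oo[].
Proof.
apply/cvg_lim; first exact: ereal_hausdorff.
apply: nondecreasing_at_right_cvge => // e d _ _ ed.
apply: ess_sup_onS; apply: setSI => y /= ye; exact: lt_le_trans ed.
Qed.

Lemma ess_limsup_le U h x e : 0 < e ->
  (ess_limsup U h x <= ess_sup_on (eball x e `&` U) h)%E.
Proof.
move=> e0; rewrite ess_limsupE; apply: ereal_inf_lbound.
by exists e => //; rewrite /= in_itv /= e0.
Qed.

Lemma ess_limsup_lt U h x (a : \bar R) : (ess_limsup U h x < a)%E ->
  exists2 e, 0 < e & (ess_sup_on (eball x e `&` U) h < a)%E.
Proof.
rewrite ess_limsupE => /ereal_inf_lt[_ [e e0 <-] ea].
by exists e => //; move: e0; rewrite /= in_itv /= andbT.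
Qed.

(** Otherwise [U] would be open and closed, and so would its trace on a line
    through one of its points: the whole line would be in [U]. *)
Lemma bdry_nonempty U : (0 < n)%N -> open U -> bounded_set U -> U !=set0 ->
  bdry U !=set0.
Proof.
move=> n0 oU [M [_ MU]] [x Ux]; apply: contrapT => bU0.
have cU : closed U.
  move=> y cy; apply: contrapT => nUy; apply: bU0; exists y; split => //.
  by move=> /interior_subset.
pose phi (t : R) : 'rV[R]_n := x + t *: const_mx 1.
have cphi : continuous phi.
  move=> t.
  apply: (@continuousD R 'rV[R]_n R (fun=> x) (fun t : R => t *: const_mx 1) t).
    exact: cst_continuous.
  exact: scalel_continuous.
have /connected_intervalP cR : is_interval [set: R] by [].
have BT : phi @^-1` U = setT.
  apply: cR.
  - by exists 0; rewrite /= /phi scale0r addr0.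
  - by exists (phi @^-1` U); rewrite ?setTI//; apply: open_comp => // t _; exact: cphi.
  - by exists (phi @^-1` U); rewrite ?setTI//; apply: closed_comp => // t _; exact: cphi.
pose i := Ordinal n0.
have : U (phi (`|M| + 1 + `|x 0 i| + 1)) by rewrite -[U _]/((phi @^-1` U) _) BT.
have Mlt : M < `|M| + 1 by apply: le_lt_trans (ler_norm M) _; rewrite ltrDl.
move=> /(MU _ Mlt); apply/negP; rewrite -ltNge.
apply: lt_le_trans (le_coord_norm _ i).
rewrite !mxE mulr1; apply: lt_le_trans (ler_norm _).
have := ler_norm (- x 0 i); rewrite normrN; have := normr_ge0 M; lra.
Qed.

End essential_limsup.

Section jets.
Context (R : realType) (n N k : nat).
Notation mu := (@lebn R n).
Implicit Types (U V Omega : set 'rV[R]_n) (u v : 'rV[R]_n -> 'rV[R]_N).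

Lemma weak_derivP U f (s : seq 'I_n) : sobolev1 k U f -> (size s <= k)%N ->
  is_weak_deriv U s f (weak_deriv U s f).
Proof.
move=> [_ df] sk; apply: (@getPex _ [set g | is_weak_deriv U s f g]).
by have [g fg _] := df s sk; exists g.
Qed.

Lemma weak_deriv_bounded U f (s : seq 'I_n) : open U -> sobolev1 k U f ->
  (size s <= k)%N ->
  exists M, {ae mu, forall x, U x -> `|weak_deriv U s f x| <= M}.
Proof.
move=> oU Wf sk; have wd := weak_derivP Wf sk.
have [_ /(_ s sk)[g fg /LinftyP[_ [M gM]]]] := Wf.
exists M; have : {ae mu, forall x, U x -> weak_deriv U s f x = g x}.
  by apply: weak_deriv_local_unique wd fg _ => //; exact: aeW.
by move: gM; apply: filterS2 => x gx wx Ux; rewrite wx//; exact: gx.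
Qed.

(** Together with [jet_dirs], names the component and the directions of a
    coordinate of the jet without a dependent match. *)
Definition jet_comp (i : 'I_(Lambda n N k)) : 'I_N :=
  let: existT _ (a, _) := enum_val i in a.
Definition jet_dirs (i : 'I_(Lambda n N k)) : seq 'I_n :=
  let: existT _ (_, s) := enum_val i in val s.

Lemma size_jet_dirs i : (size (jet_dirs i) <= k)%N.
Proof.
rewrite /jet_dirs; case: enum_val => j [a s] /=.
by rewrite size_tuple -ltnS.
Qed.

Lemma jetE U u x i : jet k U u x 0 i =
  weak_deriv U (jet_dirs i) (fun y => u y 0 (jet_comp i)) x.
Proof. by rewrite mxE /jet_dirs /jet_comp; case: enum_val => j [a s]. Qed.

Lemma jet_local U V u v : open U -> open V -> V `<=` U ->
  sobolev k U u -> sobolev k U v ->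
  {ae mu, forall x, V x -> u x = v x} ->
  {ae mu, forall x, V x -> jet k U u x = jet k U v x}.
Proof.
move=> oU oV VU Wu Wv uv.
have : {ae mu, forall x, forall i, V x -> jet k U u x 0 i = jet k U v x 0 i}.
  apply: filter_forall => i; have sk := size_jet_dirs i.
  have := weak_deriv_local_unique oU oV VU (weak_derivP (Wu (jet_comp i)) sk)
    (weak_derivP (Wv (jet_comp i)) sk).
  move=> /(_ _)/wrap[]; first by apply: filterS uv => x h /h ->.
  by apply: filterS => x h Vx; rewrite !jetE h.
by apply: filterS => x h Vx; apply/rowP => i; exact: h.
Qed.

Lemma jet_linear U u v c : open U -> sobolev k U u -> sobolev k U v ->
  {ae mu, forall x, U x ->
    jet k U (fun y => u y + c *: v y) x = jet k U u x + c *: jet k U v x}.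
Proof.
move=> oU Wu Wv.
have : {ae mu, forall x, forall i, U x ->
    jet k U (fun y => u y + c *: v y) x 0 i = jet k U u x 0 i + c * jet k U v x 0 i}.
  apply: filter_forall => i; have sk := size_jet_dirs i.
  set a := jet_comp i.
  have W : sobolev1 k U (fun y => (u y + c *: v y) 0 a).
    rewrite (_ : (fun y => _) = (fun y => u y 0 a + c * v y 0 a)); last first.
      by apply/funext => y; rewrite !mxE.
    exact: (sobolev1D oU (Wu a) (sobolev1Z c oU (Wv a))).
  have D := is_weak_derivD oU (weak_derivP (Wu a) sk)
    (is_weak_derivZ c oU (weak_derivP (Wv a) sk)).
  have := weak_deriv_local_unique oU oU (@subset_refl _ _) (weak_derivP W sk) D.
  move=> /(_ _)/wrap[]; first by apply: aeW => y _; rewrite !mxE.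
  by apply: filterS => x h Vx; rewrite !jetE h.
by apply: filterS => x h Vx; apply/rowP => i; rewrite h// !mxE.
Qed.

Lemma jet_bounded U u : open U -> sobolev k U u ->
  exists M, 0 <= M /\ {ae mu, forall x, U x -> `|jet k U u x| <= M}.
Proof.
move=> oU Wu.
have /choice[M MP] i : exists M, {ae mu, forall x, U x -> `|jet k U u x 0 i| <= M}.
  have [M MP] := weak_deriv_bounded oU (Wu (jet_comp i)) (size_jet_dirs i).
  by exists M; apply: filterS MP => x h Ux; rewrite jetE; exact: h.
have S0 : 0 <= \sum_i `|M i| by apply: sumr_ge0.
exists (\sum_i `|M i|); split => //.
have : {ae mu, forall x, forall i, U x -> `|jet k U u x 0 i| <= M i}.
  exact: filter_forall.
apply: filterS => x h Ux; apply: le_norm_coord => // i.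
apply: le_trans (h i Ux) _; apply: le_trans (ler_norm _) _.
by rewrite (bigD1 i)//= lerDl; apply: sumr_ge0.
Qed.

End jets.

(** * From the maximum principle to minimality *)

Section maximum_principle_to_minimality.
Context (R : realType) (n N k : nat).
Notation mu := (@lebn R n).

(** The jets of [u] and of its perturbation agree almost everywhere on [U `\` K],
    and small balls around boundary points of [U] only meet [U] there. *)
Lemma energy_maximum_principle_minimal (Omega : set 'rV[R]_n)
    (H : 'rV[R]_n -> 'rV[R]_(Lambda n N k) -> R) (u : 'rV[R]_n -> 'rV[R]_N) :
  open Omega -> sobolev k Omega u ->
  energy_maximum_principle Omega H u -> absolute_minimiser_c Omega H u.
Proof.
move=> oW Wu emp U oU UW phi [Wphi [K [cK KU phi0]]].
set w := u \+ _.
have Wext : sobolev k Omega (patch (cst 0) U phi).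
  move=> a; rewrite (_ : (fun y => _) = patch (fun=> 0) U (fun y => phi y 0 a)).
    apply: (sobolev1_extend oU oW UW cK KU _ (Wphi a)).
    by apply: filterS phi0 => x h /h ->; rewrite mxE.
  by apply/funext => y; rewrite /patch; case: ifP => // _; rewrite mxE.
have Ww : sobolev k Omega w.
  move=> a; rewrite (_ : (fun y => _) =
      fun y => u y 0 a + patch (cst 0) U phi y 0 a).
    exact: sobolev1D (Wu a) (Wext a).
  by apply/funext => y; rewrite /w mxE.
have oV : open (U `\` K).
  by rewrite setDE; apply: openI => //; apply: closed_openC; exact: compact_closed_rV.
have uw : {ae mu, forall x, (U `\` K) x -> u x = w x}.
  apply: filterS phi0 => x h UKx; rewrite /w /= /patch mem_set ?h ?addr0//.
  by case: UKx.
have VW : U `\` K `<=` Omega by move=> x [/UW].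
have J := jet_local oW oV VW Wu Ww uw.
rewrite /E_infty (emp U oU UW).
apply: ge_ereal_sup => _ [x [_ nUx] <-].
have nKx : (~` K) x by move=> /KU Ux; apply: nUx; rewrite (interior_id _).1.
have oK : open (~` K) by apply: closed_openC; exact: compact_closed_rV.
have /nbhs_ballP[e /= e0 eK] := oK _ nKx.
apply: le_trans (ess_limsup_le _ _ _ e0) _.
have sub : eball x e `&` U `<=` U `\` K.
  move=> y [xy Uy]; split => //; apply: eK; apply: rV_ball => // i.
  have := le_lt_trans (le_trans (le_coord_norm (y - x) i) (norm_le_enorm _)) xy.
  by rewrite !mxE distrC.
apply: (@le_trans _ _ (ess_sup_on (eball x e `&` U) (fun x => H x (jet k Omega w x)))).
  by apply: eq_ess_sup_on; apply: filterS J => y h /sub /h ->.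
by apply: ess_sup_onS => y [].
Qed.

End maximum_principle_to_minimality.

Lemma ae_countable (R : realType) (n : nat) (I : countType)
    (P : I -> 'rV[R]_n -> Prop) :
  (forall i, {ae @lebn R n, forall x, P i x}) ->
  {ae @lebn R n, forall x, forall i, P i x}.
Proof.
move=> aeP; apply/negligible_lebn.
apply: (@countable_cover_null _ _ _ (fun i => ~` [set x | P i x])) => [x /=|i].
  by move=> /existsNP[i nP]; exists i.
exact/negligible_lebn/(aeP i).
Qed.

Section integrand.
Context (R : realType) (n m : nat) (Omega : set 'rV[R]_n).
Context (H : 'rV[R]_n -> 'rV[R]_m -> R).
Notation mu := (@lebn R n).

Definition modulus_bound := forall r : R, 0 < r -> exists omega : R -> R,
  [/\ {in `]0, +oo[, continuous omega},
      {in `]0, +oo[ &, {homo omega : s t / s <= t}} &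
      omega s @[s --> 0^'+] --> 0] /\
  {ae mu, forall x, Omega x ->
    forall X X' : 'rV[R]_m,
      enorm X <= r -> enorm X' <= r -> X != X' ->
      `|H x X - H x X'| <= omega (enorm (X - X'))}.

Lemma enorm_gt0 (X : 'rV[R]_m) : X != 0 -> 0 < enorm X.
Proof. by rewrite -normr_gt0 => X0; apply: lt_le_trans (norm_le_enorm X). Qed.

(** The bounds on the points are in the sup norm, for which those of the jets
    are componentwise. *)
Lemma modulus_small : modulus_bound -> forall M a : R, 0 <= M -> 0 < a ->
  exists2 rho, 0 < rho & {ae mu, forall x, Omega x -> forall X X' : 'rV[R]_m,
    `|X| <= M -> `|X'| <= M -> enorm (X - X') <= rho -> `|H x X - H x X'| < a}.
Proof.
move=> Hm M a M0 a0.
have r0 : 0 < Num.sqrt (m%:R : R) * M + 1.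
  by rewrite ltr_wpDl// mulr_ge0.
have [w [[_ _ w0] Hw]] := Hm _ r0.
have /cvgr0Pnorm_lt/(_ _ a0) := w0.
move=> [d /= d0 dw].
exists (d / 2); first by rewrite divr_gt0.
apply: filterS Hw => x Hx Wx X X' XM XM' XX'.
have [->|XneX'] := eqVneq X X'; first by rewrite subrr normr0.
have le_r (Y : 'rV[R]_m) : `|Y| <= M -> enorm Y <= Num.sqrt m%:R * M + 1.
  move=> YM; apply: le_trans (enorm_le_norm Y) _.
  by apply: ler_wpDr => //; rewrite ler_wpM2l.
apply: le_lt_trans (Hx Wx X X' (le_r _ XM) (le_r _ XM') XneX') _.
have p : 0 < enorm (X - X') by apply: enorm_gt0; rewrite subr_eq0.
apply: le_lt_trans (ler_norm _) _; apply: dw => //=.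
by rewrite sub0r normrN gtr0_norm//; lra.
Qed.

Lemma modulus_bounded : modulus_bound ->
  {ae mu, forall x, Omega x -> H x 0 = 0} -> forall M : R, 0 <= M ->
  exists B, {ae mu, forall x, Omega x -> forall X : 'rV[R]_m,
    `|X| <= M -> H x X <= B}.
Proof.
move=> Hm H0 M M0.
have r0 : 0 < Num.sqrt (m%:R : R) * M + 1.
  by rewrite ltr_wpDl// mulr_ge0.
have [w [[_ wmono _] Hw]] := Hm _ r0.
exists `|w (Num.sqrt m%:R * M + 1)|.
move: H0 Hw; apply: filterS2 => x H0 Hx Wx X XM.
have [->|Xn0] := eqVneq X 0; first by rewrite H0.
have Xr : enorm X <= Num.sqrt m%:R * M + 1.
  apply: le_trans (enorm_le_norm X) _.
  by apply: ler_wpDr => //; rewrite ler_wpM2l.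
have e0 : enorm (0 : 'rV[R]_m) <= Num.sqrt m%:R * M + 1.
  by rewrite -(scale0r (0 : 'rV[R]_m)) enormZ normr0 mul0r ltW.
have := Hx Wx X 0 Xr e0 Xn0; rewrite H0// !subr0.
move=> /(le_trans (ler_norm _)) /le_trans; apply.
apply: le_trans (ler_norm _); apply: wmono => //; rewrite in_itv /= andbT//.
exact: enorm_gt0.
Qed.

(** Moves the quantifier over all points inside an almost everywhere statement:
    the exceptional null sets of countably many points suffice. *)
Lemma rational_ineq (F : 'rV[R]_m -> R) (V : set 'rV[R]_m) b :
  continuous F -> open V -> (forall q : 'rV[rat]_m, V (map_mx ratr q) ->
    b <= F (map_mx ratr q)) -> forall X, V X -> b <= F X.
Proof.
move=> cF oV bF X VX; rewrite leNgt; apply/negP => FX.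
have : open (V `&` F @^-1` [set s | s < b]).
  by apply: openI => //; apply: open_comp; [move=> y _; exact: cF|exact: open_lt].
move=> /(_ X (conj VX FX)) /nbhs_ballP[e /= e0 eV].
have [q /eV[Vq /=]] := rat_dense X e0.
by rewrite ltNge bF.
Qed.

(** The exceptional null set of the inequality depends on [t] and [X]. *)
Definition radial_decay (c : R * R -> R) :=
  [/\ {within `[0, 1] `*` `[0, +oo[, continuous c},
      (forall t s, 0 <= t <= 1 -> 0 <= s -> 0 <= c (t, s)),
      (forall s, 0 <= s -> c (1, s) = 0),
      (forall t, 0 <= t <= 1 -> c (t, 0) = 0) &
      (forall t s, 0 < t < 1 -> 0 < s -> 0 < c (t, s))] /\
  forall (t : R) (X : 'rV[R]_m), 0 <= t <= 1 ->
    {ae mu, forall x, Omega x ->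
      H x (t *: X) <= H x X - c (t, enorm X)}.

Lemma radial_min c t p q : radial_decay c -> 0 < t < 1 -> 0 < p -> p <= q ->
  exists2 c0, 0 < c0 & forall s, p <= s <= q -> c0 <= c (t, s).
Proof.
move=> [[cc _ _ _ cpos] _] t01 p0 pq.
have [|s0 s0pq smin] := @EVT_min R (fun s => c (t, s)) p q pq.
  apply/subspace_continuousP => s /= spq.
  have As : (`[0, 1] `*` `[0, +oo[)%classic (t, s).
    move: spq; rewrite /= !in_itv /= andbT => /andP[ps _].
    by case/andP: t01 => /ltW -> /ltW ->; split => //; lra.
  move/subspace_continuousP : cc => /(_ _ As) cc.
  apply: cvg_trans cc => A [/= [B1 B2] [/= B1t B2s] BA].
  rewrite /from_subspace /=.
  suff : \forall y \near s, y \in `[p, q] -> A (c (t, y)) by [].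
  apply: filterS B2s => y B2y; rewrite in_itv /= => /andP[py _].
  apply: (BA (t, y)); first by split => //; exact: nbhs_singleton B1t.
  case/andP: t01 => t0 t1; rewrite !in_itv /= (ltW t0) (ltW t1); split => //.
  lra.
exists (c (t, s0)).
  move: s0pq; rewrite in_itv /= => /andP[ps0 _]; apply: cpos => //.
  exact: lt_le_trans ps0.
by move=> s spq; apply: smin; rewrite in_itv.
Qed.

(** The decay [c (t, .)] is bounded below by a positive constant on compact
    intervals away from 0. The interval is taken larger than the range of the
    norms of [X], so that rational points near [X] stay in it. *)
Lemma radial_decrease c t : radial_decay c ->
  {ae mu, forall x, Omega x -> continuous (H x)} -> 0 < t < 1 ->
  {ae mu, forall x, Omega x -> forall X, H x (t *: X) <= H x X} /\
  forall rho M, 0 < rho -> exists2 c0, 0 < c0 &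
    {ae mu, forall x, Omega x -> forall X : 'rV[R]_m, rho <= enorm X -> `|X| <= M ->
      H x (t *: X) <= H x X - c0}.
Proof.
move=> rc Hc t01; have [[_ c_ge0 _ _ _] Hdec] := rc.
have t01' : 0 <= t <= 1 by case/andP: t01 => /ltW -> /ltW ->.
have Hq : {ae mu, forall x, forall q : 'rV[rat]_m, Omega x ->
    H x (t *: map_mx ratr q) <=
    H x (map_mx ratr q) - c (t, enorm (map_mx ratr q : 'rV[R]_m))}.
  by apply: ae_countable => q; exact: Hdec.
have cF x : continuous (H x) -> continuous (fun X => H x X - H x (t *: X)).
  move=> cH; rewrite (_ : (fun X => _) = (fun X => H x X + -1 * H x (t *: X))).
    apply: continuous_addf => //; apply: continuous_mulf; first exact: cst_continuous.
    move=> X; apply: (@continuous_comp _ _ R (fun X : 'rV[R]_m => t *: X : 'rV[R]_m) (H x)).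
      exact: scaler_continuous.
    exact: cH.
  by apply/funext => X; rewrite mulN1r.
split.
  move: Hc Hq; apply: filterS2 => x cH Hq Wx X; rewrite -subr_ge0.
  apply: (@rational_ineq (fun X => H x X - H x (t *: X)) setT 0) => //.
  - exact/cF/cH.
  - exact: openT.
  - move=> q _; rewrite subr_ge0; apply: le_trans (Hq q Wx) _.
    by rewrite gerBl c_ge0// enorm_ge0.
move=> rho M rho0.
pose r := Num.max (rho / 2) (Num.sqrt m%:R * M + 1).
have [||c0 c00 cmin] := @radial_min c t (rho / 2) r rc t01.
- by rewrite divr_gt0.
- by rewrite le_max lexx.
exists c0 => //; move: Hc Hq; apply: filterS2 => x cH Hq Wx X rX XM.
rewrite lerBrDr -lerBrDl.
apply: (@rational_ineq (fun X => H x X - H x (t *: X))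
  (@enorm R m @^-1` `]rho / 2, r[%classic) c0).
- exact/cF/cH.
- by apply: open_comp; [move=> y _; exact: enorm_continuous|exact: itv_open].
- move=> q; rewrite /= in_itv /= => /andP[/ltW q1 /ltW q2].
  rewrite lerBrDr -lerBrDl; apply: le_trans (Hq q Wx) _.
  by rewrite lerD2l lerN2 cmin// q1.
rewrite /= in_itv /=; apply/andP; split; first lra.
apply: le_lt_trans (enorm_le_norm X) _; rewrite lt_max; apply/orP; right.
by apply: ltr_pwDr => //; rewrite ler_wpM2l.
Qed.

End integrand.

(** * From minimality to the maximum principle *)

Section minimality_to_maximum_principle.
Context (R : realType) (n N k : nat).
Notation mu := (@lebn R n).
Implicit Types (U V : set 'rV[R]_n).

(** If [V] were null then every set would be, and the supremum over [U] would be
    [-oo]. *)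
Lemma ess_sup_on_ge0 U V h : open V -> V !=set0 ->
  (forall x, V x -> 0 <= h x) -> ess_sup_on U h <> -oo%E ->
  (0 <= ess_sup_on V h)%E.
Proof.
move=> oV V0 h0 UN; rewrite leNgt; apply/negP => Vneg; apply: UN.
have Vnull : lebn V = 0%E.
  apply/negligible_lebn.
  have /ess_sup_on_leP := lexx (ess_sup_on V h).
  apply: negligibleS => x Vx /(_ Vx); rewrite leNgt => /negP; apply.
  by apply: lt_le_trans Vneg _; rewrite lee_fin h0.
have null := open_null_setT oV V0 Vnull.
apply/eqP; rewrite -leeNy_eq; apply/ess_sup_on_leP.
by apply/negligible_lebn; exact: null.
Qed.

Lemma ae_all_seq (T : eqType) (D : seq T) (P : T -> 'rV[R]_n -> Prop) :
  (forall c, c \in D -> {ae mu, forall x, P c x}) ->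
  {ae mu, forall x, forall c, c \in D -> P c x}.
Proof.
elim: D => [|d D IH] aeP; first exact: aeW.
have := IH (fun c cD => aeP c (mem_behead (s := d :: D) cD)).
have := aeP d (mem_head _ _).
apply: filterS2 => x Pd PD c; rewrite inE => /predU1P[->//|]; exact: PD.
Qed.

Lemma compact_bdry U : bounded_set U -> compact (bdry U) /\ compact (closure U).
Proof.
move=> [M [_ MU]].
have Mlt : M < `|M| + 1 by apply: le_lt_trans (ler_norm M) _; rewrite ltrDl.
have cB : compact [set y : 'rV[R]_n | `|y - 0| <= `|M| + 1] by apply: compact_norm_ball.
have clB : closure U `<=` [set y : 'rV[R]_n | `|y - 0| <= `|M| + 1].
  rewrite [X in _ `<=` X](closure_id _).1; last exact: compact_closed_rV.
  by apply: closure_subset => y Uy; rewrite /= subr0; exact: MU Uy.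
have cU : compact (closure U).
  by apply: subclosed_compact cB clB; exact: closed_closure.
split => //; apply: subclosed_compact cU _; last by move=> x [].
rewrite /bdry setDE; apply: closedI; first exact: closed_closure.
by apply: open_closedC; exact: open_interior.
Qed.

(** Finitely many balls on which [h] is below [a] cover the compact boundary; [K]
    is what they leave of the closure of [U]. *)
Lemma small_near_bdry U (h : 'rV[R]_n -> R) (a : \bar R) : open U -> bounded_set U ->
  (forall x, bdry U x -> (ess_limsup U h x < a)%E) ->
  exists K, [/\ compact K, K `<=` U &
    {ae mu, forall x, (U `\` K) x -> ((h x)%:E <= a)%E}].
Proof.
move=> oU bU ha; have [cbU ccU] := compact_bdry bU.
have /choice[e eP] (x : 'rV[R]_n) : exists e, 0 < e /\
    (bdry U x -> (ess_sup_on (eball x e `&` U) h < a)%E).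
  have [/ha/ess_limsup_lt[e e0 ea]|nbx] := pselect (bdry U x); last by exists 1.
  by exists e.
have cbU' := cbU; rewrite compact_cover in cbU'.
have [] := cbU' _ (bdry U) (fun c => eball c (e c)).
- by move=> c _; exact: open_eball.
- by move=> x bx; exists x => //; apply: eball_center; case: (eP x).
move=> D0 Db bD; pose D : seq 'rV[R]_n := finmap.enum_fset D0.
pose G := \bigcup_(c in [set` D]) eball c (e c).
have oG : open G by apply: bigcup_open => c _; exact: open_eball.
exists (closure U `\` G); split.
- apply: subclosed_compact ccU _; last by move=> x [].
  rewrite setDE; apply: closedI; first exact: closed_closure.
  exact: open_closedC.
- move=> x [clx nGx]; apply: contrapT => nUx; apply: nGx; apply: bD.
  by split => //; move=> /interior_subset.
have : {ae mu, forall x, forall c, c \in D -> (eball c (e c) `&` U) x ->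
    ((h x)%:E <= a)%E}.
  apply: ae_all_seq => c cD; apply/ess_sup_on_leP; apply: ltW.
  by have [_] := eP c; apply; apply: set_mem; exact: Db.
apply: filterS => x hx [Ux nK].
have [c cD xc] : G x.
  by apply: contrapT => nGx; apply: nK; split => //; exact: subset_closure.
exact: (hx c cD).
Qed.

(** The competitor is [u - s z u], with [z] a cutoff near the compact set outside
    of which [h <= a], and [s] small with respect to the modulus of
    continuity. *)
Lemma minimal_energy_maximum_principle (Omega : set 'rV[R]_n)
    (H : 'rV[R]_n -> 'rV[R]_(Lambda n N k) -> R) (u : 'rV[R]_n -> 'rV[R]_N)
    (c : R * R -> R) :
  (0 < n)%N -> open Omega -> bounded_set Omega ->
  (forall x X, Omega x -> 0 <= H x X) ->
  {ae mu, forall x, Omega x -> continuous (H x)} ->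
  {ae mu, forall x, Omega x -> H x 0 = 0} ->
  radial_decay Omega H c -> modulus_bound Omega H -> sobolev k Omega u ->
  absolute_minimiser_c Omega H u -> energy_maximum_principle Omega H u.
Proof.
move=> n0 oW bW H_ge0 Hcont H0 Hrad Hmod Wu umin U oU UW h.
have bU : bounded_set U.
  move: bW => [M [Mr MW]]; exists M; split => // x Mx y /UW; exact: MW.
apply/eqP; rewrite eq_le; apply/andP; split; last first.
  apply: ge_ereal_sup => _ [x _ <-].
  apply: le_trans (ess_limsup_le U h x ltr01) _.
  by apply: ess_sup_onS => y [].
rewrite leNgt; apply/negP.
set m := ereal_sup _; set M := ess_sup_on U h => mM.
have U0 : U !=set0.
  apply/set0P/eqP => U0; move: mM; rewrite /M U0.
  rewrite (_ : ess_sup_on _ _ = -oo%E) ?ltNge ?leNye//.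
  by apply/eqP; rewrite -leeNy_eq; apply/ess_sup_on_leP; exact: aeW.
have m0 : (0 <= m)%E.
  have [x bx] := bdry_nonempty n0 oU bU U0.
  apply: (@le_trans _ _ (ess_limsup U h x)); last first.
    by apply: ereal_sup_ubound; exists x.
  rewrite leNgt; apply/negP => /ess_limsup_lt[e e0]; apply/negP; rewrite -leNgt.
  apply: (@ess_sup_on_ge0 U).
  - by apply: openI => //; exact: open_eball.
  - have nx : nbhs x (eball x e).
      by apply: open_nbhs_nbhs; split; [exact: open_eball|exact: eball_center].
    by have [y [Uy ey]] := bx.1 _ nx; exists y.
  - by move=> y [_ /UW Wy]; exact: H_ge0.
  - by move=> ME; move: mM; rewrite /M ME ltNge leNye.
have [M0 [M00 JM0]] := jet_bounded oW Wu.
have Moo : (M < +oo)%E.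
  have [B HB] := modulus_bounded Hmod H0 M00.
  apply: le_lt_trans (ltry B); apply/ess_sup_on_leP.
  move: HB JM0; apply: filterS2 => x HB JM /UW Wx; rewrite lee_fin.
  by apply: HB => //; exact: JM.
have [mr mE] : exists r, m = r%:E.
  case: (m) mM m0 => [r _ _|+ _|_]; [by exists r| |by []].
  by rewrite ltNge leey.
have [Mr ME] : exists r, M = r%:E.
  case: (M) mM Moo => [r _ _|_|+ _]; [by exists r|by []|].
  by rewrite ltNge leNye.
move: mM m0; rewrite mE ME lte_fin lee_fin => mM m0.
pose a := (2 * mr + Mr) / 3; pose b := (mr + 2 * Mr) / 3.
have ma : mr < a by rewrite /a; lra.
have ab : a < b by rewrite /a /b; lra.
have bM : b < Mr by rewrite /b; lra.
have a0 : 0 < a by lra.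
have ba0 : 0 < b - a by lra.
have hb x : bdry U x -> (ess_limsup U h x < a%:E)%E.
  move=> bx; apply: (@le_lt_trans _ _ m); last by rewrite mE lte_fin.
  by apply: ereal_sup_ubound; exists x.
have [K [cK KU hK]] := small_near_bdry oU bU hb.
have [z [[sz cz zU] z01 [V [oV KV z1]]]] := cutoff cK oU KU.
pose v y := z y *: u y.
have Wv : sobolev k Omega v.
  move=> i; rewrite (_ : (fun y => _) = fun y => z y * u y 0 i).
    by apply: sobolev1M => //; exact: Wu.
  by apply/funext => y; rewrite /v mxE.
have [M1 [M10 JM1]] := jet_bounded oW Wv.
have M01 : 0 <= M0 + M1 by rewrite addr_ge0.
have [rho1 rho10 Hrho1] := modulus_small Hmod M01 ba0.
have [rho2 rho20 Hrho2] := modulus_small Hmod M01 a0.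
(* [s * Q] bounds the Euclidean norm of the change of the jet, and [s <= 1 / 2]
   keeps [t] positive. *)
pose Q := Num.sqrt ((Lambda n N k)%:R : R) * M1 + 1.
have Q0 : 0 < Q by rewrite ltr_wpDl// mulr_ge0.
pose s := Num.min (1 / 2) (rho1 / Q).
have s0 : 0 < s by rewrite lt_min; apply/andP; split; rewrite divr_gt0.
have s12 : s <= 1 / 2 by rewrite ge_min lexx.
have sQ : s * Q <= rho1.
  by rewrite -ler_pdivlMr// ge_min lexx orbT.
pose t := 1 - s.
have t01 : 0 < t < 1 by rewrite /t; apply/andP; split; lra.
have [Hle /(_ rho2 (M0 + M1) rho20)[c0 c00 Hc0]] := radial_decrease Hrad Hcont t01.
pose phi y := (- s) *: v y.
have phi_ext : u \+ patch (cst 0) U phi = fun y => u y + (- s) *: v y.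
  apply/funext => y /=; rewrite /patch; case: ifPn => // /negP nUy; congr (_ + _).
  rewrite /v (not_supp (h := z)) ?scale0r ?scaler0// => /zU/mem_set //.
have Wphi : sobolev_c k U phi.
  split.
    move=> i; rewrite (_ : (fun y => _) = fun y => - s * v y 0 i); last first.
      by apply/funext => y; rewrite /phi mxE.
    exact: (sobolev1Z (- s) oU (sobolev1S oW UW (Wv i))).
  exists (supp z); split => //; apply: aeW => x [_ nz].
  by rewrite /phi /v (not_supp nz) scale0r scaler0.
have JL := jet_linear (- s) oW Wu Wv.
have oVU : open (V `&` U) by exact: openI.
have VUW : V `&` U `<=` Omega by move=> x [_ /UW].
have JV : {ae mu, forall x, (V `&` U) x -> jet k Omega v x = jet k Omega u x}.
  apply: (jet_local oW oVU VUW Wv Wu); apply: aeW => x [Vx _].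
  by rewrite /v z1// scale1r.
have hM : {ae mu, forall x, U x -> ((h x)%:E <= M)%E}.
  by apply/ess_sup_on_leP.
have key : {ae mu, forall x, U x ->
    H x (jet k Omega (fun y => u y + (- s) *: v y) x) <= Num.max b (Mr - c0)}.
  near=> x => Ux; have Wx := UW x Ux.
  have -> : jet k Omega (fun y => u y + (- s) *: v y) x =
      jet k Omega u x + (- s) *: jet k Omega v x.
    by move: Wx; near: x; exact: JL.
  have Jle : `|jet k Omega u x| <= M0 by move: Wx; near: x; exact: JM0.
  have vle : `|jet k Omega v x| <= M1 by move: Wx; near: x; exact: JM1.
  have Jle' : `|jet k Omega u x| <= M0 + M1 by lra.
  rewrite le_max.
  (* On [K] the cutoff is 1 near [x], and the jet is scaled by [t]. *)
  have [Kx|nKx] := pselect (K x).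
    have VUx : (V `&` U) x by split => //; exact: KV.
    have -> : jet k Omega v x = jet k Omega u x.
      by move: VUx; near: x; exact: JV.
    have -> : jet k Omega u x + (- s) *: jet k Omega u x = t *: jet k Omega u x.
      by rewrite scaleNr /t scalerBl scale1r.
    have [ha|ha] := leP (h x) a.
      apply/orP; left; apply: (@le_trans _ _ (h x)); last by lra.
      by rewrite /h; move: Wx (jet k Omega u x); near: x; exact: Hle.
    have hx0 : H x 0 = 0 by move: Wx; near: x; exact: H0.
    (* The drop needs a jet away from 0, as [c (t, 0) = 0]. *)
    have rhoJ : rho2 <= enorm (jet k Omega u x).
      rewrite leNgt; apply/negP => /ltW Jrho.
      have : `|H x (jet k Omega u x) - H x 0| < a.
        have n0' : `|0 : 'rV[R]_(Lambda n N k)| <= M0 + M1 by rewrite normr0.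
        have Jrho' : enorm (jet k Omega u x - 0) <= rho2 by rewrite subr0.
        move: Jle' n0' Jrho'.
        move: Wx (jet k Omega u x) (0 : 'rV[R]_(Lambda n N k)).
        by near: x; exact: Hrho2.
      by rewrite hx0 subr0 ger0_norm ?H_ge0// -/(h x) ltNge ltW.
    apply/orP; right; apply: (@le_trans _ _ (h x - c0)).
      by rewrite /h; move: rhoJ Jle'; move: Wx (jet k Omega u x); near: x; exact: Hc0.
    rewrite lerD2r -lee_fin -ME; move: Ux; near: x; exact: hM.
  (* Outside [K] the jet moves by at most [rho1]. *)
  apply/orP; left.
  have ha : h x <= a.
    rewrite -lee_fin; have : (U `\` K) x by []. 
    by near: x; exact: hK.
  have wle : `|jet k Omega u x + (- s) *: jet k Omega v x| <= M0 + M1.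
    apply: le_trans (ler_normD _ _) _; apply: lerD => //.
    rewrite normrZ normrN gtr0_norm//; apply: le_trans vle.
    by rewrite ler_piMl//; lra.
  have dle : enorm (jet k Omega u x + (- s) *: jet k Omega v x - jet k Omega u x)
      <= rho1.
    rewrite addrC addKr enormZ normrN gtr0_norm//; apply: le_trans sQ.
    rewrite ler_pM2l//; apply: le_trans (enorm_le_norm _) _.
    by apply: ler_wpDr => //; rewrite ler_wpM2l.
  have : `|H x (jet k Omega u x + (- s) *: jet k Omega v x) - H x (jet k Omega u x)|
      < b - a.
    move: wle Jle' dle.
    move: (jet k Omega u x + (- s) *: jet k Omega v x) => X.
    move: (jet k Omega u x) => X'.
    by move: X X'; move: Wx; near: x; exact: Hrho1.
  rewrite ltr_norml -/(h x) => /andP[_]; lra.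
have := umin U oU UW phi Wphi; rewrite phi_ext.
rewrite {1}/E_infty -/h -/M ME leNgt => /negP; apply.
apply: (@le_lt_trans _ _ (Num.max b (Mr - c0))%:E).
  by apply/ess_sup_on_leP; apply: filterS key => x kx Ux; rewrite lee_fin kx.
by rewrite lte_fin gt_max bM ltrBlDr ltrDl.
Unshelve. all: by end_near. Qed.

End minimality_to_maximum_principle.

Theorem theorem1p5 (R : realType) (n N k : nat)
    (n_gt0 : (0 < n)%N) (N_gt0 : (0 < N)%N) (k_gt0 : (0 < k)%N)
    (Omega : set 'rV[R]_n) (openOmega : open Omega)
    (boundedOmega : bounded_set Omega)
    (H : 'rV[R]_n -> 'rV[R]_(Lambda n N k) -> R)
    (H_ge0 : forall x X, Omega x -> 0 <= H x X)
    (H_car : caratheodory_fun Omega H)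
    (H_0 : {ae @lebn R n, forall x, Omega x -> H x 0 = 0})
    (H_radial : exists c : R * R -> R,
      [/\ {within `[0, 1] `*` `[0, +oo[, continuous c},
          (forall t s, 0 <= t <= 1 -> 0 <= s -> 0 <= c (t, s)),
          (forall s, 0 <= s -> c (1, s) = 0),
          (forall t, 0 <= t <= 1 -> c (t, 0) = 0) &
          (forall t s, 0 < t < 1 -> 0 < s -> 0 < c (t, s))] /\
      forall (t : R) (X : 'rV[R]_(Lambda n N k)), 0 <= t <= 1 ->
        {ae @lebn R n, forall x, Omega x ->
          H x (t *: X) <= H x X - c (t, enorm X)})
    (H_modulus : forall r : R, 0 < r -> exists omega : R -> R,
      [/\ {in `]0, +oo[, continuous omega},
          {in `]0, +oo[ &, {homo omega : s t / s <= t}} &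
          omega s @[s --> 0^'+] --> 0] /\
      {ae @lebn R n, forall x, Omega x ->
        forall X X' : 'rV[R]_(Lambda n N k),
          enorm X <= r -> enorm X' <= r -> X != X' ->
          `|H x X - H x X'| <= omega (enorm (X - X'))})
    (u : 'rV[R]_n -> 'rV[R]_N) (u_sobolev : sobolev k Omega u) :
  energy_maximum_principle Omega H u <-> absolute_minimiser_c Omega H u.
Proof.
have Hcont := H_car.2.
split; first exact: energy_maximum_principle_minimal.
have [c Hc] := H_radial.
exact: (minimal_energy_maximum_principle n_gt0 openOmega boundedOmega H_ge0
  Hcont H_0 Hc).
Qed.
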